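(* For every real $\varepsilon>0$ and every $n\ge1$, $\varepsilon\text{-}\operatorname{Proj}_{\mathbb{R}^n}$ is computable, i.e. it has a computable realizer.
   Context: Represented spaces: a representation of a set $X$ is a partial surjection $\delta_X:\subseteq\mathbb{N}^\mathbb{N}\to X$. For a partial multi-valued function $f:\subseteq X\rightrightarrows Y$, a realizer is a partial $F:\subseteq\mathbb{N}^\mathbb{N}\to\mathbb{N}^\mathbb{N}$ with $\delta_Y(F(p))\in f(\delta_X(p))$ for all $p$ with $\delta_X(p)\in\mathrm{dom}(f)$; $f$ is computable if it has a realizer computed by a Turing machine on infinite sequences. $\mathbb{R}^n$ has the Euclidean metric and the Cauchy representation (names are sequences $(q_i)$ in $\mathbb{Q}^n$ with $d(q_i,q_j)\le2^{-i}$ for $j\ge i$, naming the limit). Basic balls are open balls $B(c,r)$ with $c\in\mathbb{Q}^n$, $r$ a nonnegative rational. $\mathcal{A}(\mathbb{R}^n)$ (total information): a name of a closed set $A$ consists of an enumeration of basic balls whose union is $\mathbb{R}^n\setminus A$ together with an enumeration of exactly the basic balls meeting $A$. For $\varepsilon>0$, $\varepsilon\text{-}\operatorname{Proj}_{\mathbb{R}^n}:\subseteq\mathbb{R}^n\times\mathcal{A}(\mathbb{R}^n)\rightrightarrows\mathbb{R}^n$ maps $(x,A)$ with $A$ nonempty closed to the set of $y\in A$ with $d(x,y)\le(1+\varepsilon)\,d(x,A)$ ($\varepsilon$ is fixed, not part of the input). *)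

(* Defs.v *)
From Stdlib Require Import Reals QArith Qabs Qreals Lra Lia ZArith Arith List Cantor.
Import ListNotations.
Open Scope R_scope.

Inductive recf : Type :=
| Rzero : recf
| Rsucc : recf
| Rproj : nat -> recf
| Rcomp : recf -> list recf -> recf
| Rprim : recf -> recf -> recf
| Rmin  : recf -> recf.

Inductive eval : recf -> list nat -> nat -> Prop :=
| ev_zero : forall v, eval Rzero v 0
| ev_succ : forall x v, eval Rsucc (x :: v) (S x)
| ev_proj : forall i v, (i < length v)%nat -> eval (Rproj i) v (nth i v 0%nat)
| ev_comp : forall f gs v ws y,
    evals gs v ws -> eval f ws y -> eval (Rcomp f gs) v y
| ev_prim0 : forall f g v y, eval f v y -> eval (Rprim f g) (0%nat :: v) y
| ev_primS : forall f g n v y z,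
    eval (Rprim f g) (n :: v) y -> eval g (n :: y :: v) z ->
    eval (Rprim f g) (S n :: v) z
| ev_min : forall f v n,
    eval f (n :: v) 0%nat ->
    (forall m, (m < n)%nat -> exists y, eval f (m :: v) (S y)) ->
    eval (Rmin f) v n
with evals : list recf -> list nat -> list nat -> Prop :=
| evs_nil : forall v, evals [] v []
| evs_cons : forall g gs v y ys,
    eval g v y -> evals gs v ys -> evals (g :: gs) v (y :: ys).

Definition baire := nat -> nat.

Fixpoint code_list (l : list nat) : nat :=
  match l with
  | [] => 0%nat
  | x :: l' => S (Cantor.to_nat (x, code_list l'))
  end.

Definition prefix (p : baire) (k : nat) : list nat := map p (seq 0 k).

(* A recursive associate [e] computes the output [q] from the input [p]:
   [e] applied to (code of p|k, i) returning [S v] means "q i = v",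
   returning 0 means "need more input"; every position i gets answered
   for some k, and all answers are consistent. *)
Definition computes_on (e : recf) (p q : baire) : Prop :=
  forall i : nat,
    (exists k, eval e [code_list (prefix p k); i] (S (q i))) /\
    (forall k v, eval e [code_list (prefix p k); i] (S v) -> v = q i).

Definition Rn (n : nat) : Type :=
  { x : nat -> R | forall i, (n <= i)%nat -> x i = 0 }.

Definition coord {n} (x : Rn n) (i : nat) : R := proj1_sig x i.

Fixpoint sum_lt (n : nat) (f : nat -> R) : R :=
  match n with
  | O => 0
  | S m => sum_lt m f + f m
  end.

Definition dist {n} (x y : Rn n) : R :=
  sqrt (sum_lt n (fun i => (coord x i - coord y i) ^ 2)).

Definition is_inf (S : R -> Prop) (m : R) : Prop :=
  (forall s, S s -> m <= s) /\ (forall b, (forall s, S s -> b <= s) -> b <= m).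

Definition open_set {n} (U : Rn n -> Prop) : Prop :=
  forall x, U x -> exists r, 0 < r /\ forall y, dist x y < r -> U y.

Definition closed_set {n} (A : Rn n -> Prop) : Prop :=
  open_set (fun x => ~ A x).

Definition nu_Z (k : nat) : Z :=
  if Nat.even k then Z.of_nat (Nat.div2 k) else (- Z.of_nat (S (Nat.div2 k)))%Z.

Definition nu_Q (k : nat) : Q :=
  let (a, b) := Cantor.of_nat k in Qmake (nu_Z a) (Pos.of_succ_nat b).

Fixpoint decode_aux (fuel z : nat) : list nat :=
  match fuel with
  | O => []
  | S f => match z with
           | O => []
           | S z' => let (x, y) := Cantor.of_nat z' in x :: decode_aux f y
           end
  end.
Definition decode_list (z : nat) : list nat := decode_aux z z.

Definition nu_Qn_fun (n k : nat) (i : nat) : R :=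
  if Nat.ltb i n then Q2R (nu_Q (nth i (decode_list k) 0%nat)) else 0.

Lemma nu_Qn_fun_spec (n k : nat) :
  forall i, (n <= i)%nat -> nu_Qn_fun n k i = 0.
Proof.
  intros i Hi. unfold nu_Qn_fun.
  destruct (Nat.ltb_spec i n); [lia | reflexivity].
Qed.

Definition nu_Qn (n k : nat) : Rn n := exist _ (nu_Qn_fun n k) (nu_Qn_fun_spec n k).

Definition ball_center (n k : nat) : Rn n := nu_Qn n (fst (Cantor.of_nat k)).
Definition ball_radius (k : nat) : R := Q2R (Qabs (nu_Q (snd (Cantor.of_nat k)))).

Definition in_ball (n k : nat) (y : Rn n) : Prop :=
  dist (ball_center n k) y < ball_radius k.

Definition cauchy_name (n : nat) (p : baire) (x : Rn n) : Prop :=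
  (forall i j, (i <= j)%nat -> dist (nu_Qn n (p i)) (nu_Qn n (p j)) <= / 2 ^ i) /\
  (forall eps, 0 < eps -> exists N, forall i, (N <= i)%nat ->
       dist (nu_Qn n (p i)) x < eps).

Definition pi1 (p : baire) : baire := fun i => p (2 * i)%nat.
Definition pi2 (p : baire) : baire := fun i => p (S (2 * i)).

(* A(R^n), total information: negative info (balls covering the complement)
   and positive info (exactly the basic balls meeting A). *)
Definition closed_name (n : nat) (p : baire) (A : Rn n -> Prop) : Prop :=
  (forall y, ~ A y <-> exists i, in_ball n (pi1 p i) y) /\
  (forall k, (exists y, A y /\ in_ball n k y) <->
             exists i, ball_center n (pi2 p i) = ball_center n k /\
                       ball_radius (pi2 p i) = ball_radius k).

Definition pair_name (n : nat) (p : baire) (x : Rn n) (A : Rn n -> Prop) : Prop :=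
  cauchy_name n (pi1 p) x /\ closed_name n (pi2 p) A.

Definition eps_Proj (eps : R) (n : nat) (x : Rn n) (A : Rn n -> Prop) (y : Rn n)
  : Prop :=
  A y /\ exists d, is_inf (fun s => exists a, A a /\ s = dist x a) d /\
                   dist x y <= (1 + eps) * d.

Definition eps_Proj_dom (n : nat) (x : Rn n) (A : Rn n -> Prop) : Prop :=
  (exists a, A a) /\ closed_set A.

Definition eps_Proj_computable (eps : R) (n : nat) : Prop :=
  exists e : recf,
    forall (p : baire) (x : Rn n) (A : Rn n -> Prop),
      pair_name n p x A -> eps_Proj_dom n x A ->
      exists q : baire, computes_on e p q /\
        exists y : Rn n, cauchy_name n q y /\ eps_Proj eps n x A y.

(* Main.v *)
Require Import Defs.
From Stdlib Require Import Reals QArith Qabs Qreals Lra Lia ZArith Arith List Cantor.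
From Stdlib Require Import Classical IndefiniteDescription.
Import ListNotations.
Open Scope R_scope.

(* Let d = d(x, A).  The algorithm searches for a sequence of basic balls B(c, r) from the
   positive information, with r at least halved and the centre moved by at most 4 times the
   old radius at each step, each ball satisfying one of two conditions verifiable from a
   finite part of the input: |c - x| <= r, or |c - x| + r <= (1 + e) l for a certified lower
   bound l <= d, where e <= eps is rational.  In both cases |c - x| <= r + (1 + e) d, so the
   limit y of the centres satisfies d(x, y) <= (1 + e) d, and y is in A because all balls meet
   the closed set A.  The search never gets stuck: if d = 0, small balls around x satisfy the
   first condition; if d > 0, a ball of the first kind is close to almost nearest points of A,
   and a ball of the second kind contains points of A that are strictly closer to x than
   (1 + e) d, so in both cases a small ball around a suitable point satisfies the second
   condition.  Lower bounds of d are certified by covering a closed ball around x, up to a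
   grid, by finitely many balls of the complement; compactness yields all rationals l < d.
   The first witness of a search depends on the input only, not on the length of the prefix
   that is read, so the answers obtained from different prefixes agree. *)

(** * Recursive functions on codes *)

Lemma evals_functional (gs : list recf) :
  Forall (fun g => forall v y y', eval g v y -> eval g v y' -> y = y') gs ->
  forall v ws ws', evals gs v ws -> evals gs v ws' -> ws = ws'.
Proof.
  induction 1 as [|g gs Hg _ IH]; intros v ws ws' H H'; inversion H; inversion H'; subst;
    [reflexivity|]. f_equal; eauto.
Qed.

(** An explicit [fix] is needed because the generated induction principle of [recf] gives no
    hypothesis for the list inside [Rcomp]. [Rprim] takes an inner induction on the counter. For
    [Rmin], the smaller of two different minima would receive both a zero and a successor value. *)
Lemma eval_functional (e : recf) :
  forall (v : list nat) (y y' : nat), eval e v y -> eval e v y' -> y = y'.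
Proof.
  revert e; fix IH 1; intros [| |i|f gs|f g|f] v y y' H H'.
  - inversion H; inversion H'; subst; reflexivity.
  - inversion H; inversion H'; subst. congruence.
  - inversion H; inversion H'; subst; reflexivity.
  - assert (Hgs : Forall (fun g => forall v y y', eval g v y -> eval g v y' -> y = y') gs)
      by (clear H H'; induction gs; [apply Forall_nil | apply Forall_cons;
        [apply IH | assumption]]).
    inversion H as [| | |? ? ? ws ? Hws Hf| | |]; subst.
    inversion H' as [| | |? ? ? ws' ? Hws' Hf'| | |]; subst.
    rewrite <- (evals_functional gs Hgs v ws ws' Hws Hws') in Hf'.
    exact (IH f _ _ _ Hf Hf').
  - assert (Hn : forall n w y y', eval (Rprim f g) (n :: w) y ->
                   eval (Rprim f g) (n :: w) y' -> y = y').
    { intros n w. induction n as [|n IHn]; intros z z' K K'.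
      - inversion K; inversion K'; subst. eapply IH; eassumption.
      - inversion K as [| | | | |? ? ? ? u ? Ku Kz|]; subst.
        inversion K' as [| | | | |? ? ? ? u' ? Ku' Kz'|]; subst.
        rewrite <- (IHn _ _ Ku Ku') in Kz'. exact (IH g _ _ _ Kz Kz'). }
    destruct v as [|n w]; [inversion H|]. exact (Hn n w y y' H H').
  - inversion H as [| | | | | |? ? ? H0 Hlt]; subst.
    inversion H' as [| | | | | |? ? ? H0' Hlt']; subst.
    destruct (lt_eq_lt_dec y y') as [[L|E]|L]; auto.
    + destruct (Hlt' y L) as [u Hu]. discriminate (IH f _ _ _ H0 Hu).
    + destruct (Hlt y' L) as [u Hu]. discriminate (IH f _ _ _ H0' Hu).
Qed.

Definition r_add : recf := Rprim (Rproj 0) (Rcomp Rsucc [Rproj 1]).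
Definition r_pred : recf := Rprim Rzero (Rproj 0).
Definition r_subr : recf := Rprim (Rproj 0) (Rcomp r_pred [Rproj 1]).
Definition r_sub : recf := Rcomp r_subr [Rproj 1; Rproj 0].
Definition r_tri : recf :=
  Rprim Rzero (Rcomp r_add [Rcomp Rsucc [Rproj 0]; Rproj 1]).
Definition r_pair : recf :=
  Rcomp r_add [Rproj 1; Rcomp r_tri [Rcomp r_add [Rproj 1; Rproj 0]]].

Ltac ev_step := first
  [ apply ev_succ | apply ev_zero
  | apply (ev_proj 0); simpl; lia
  | apply (ev_proj 1); simpl; lia
  | apply (ev_proj 2); simpl; lia
  | apply evs_nil | eapply evs_cons | eapply ev_comp ].
Ltac ev := repeat (first [eassumption | ev_step]).

Lemma ev_add x y : eval r_add [x; y] (x + y).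
Proof. induction x; [apply ev_prim0 | eapply ev_primS; [exact IHx|]]; ev. Qed.

Lemma ev_pred x : eval r_pred [x] (pred x).
Proof. induction x; [apply ev_prim0 | eapply ev_primS; [exact IHx|]]; ev. Qed.

Lemma ev_sub x y : eval r_sub [x; y] (x - y).
Proof.
  assert (H : eval r_subr [y; x] (x - y)).
  { induction y.
    - rewrite Nat.sub_0_r. apply ev_prim0; ev.
    - rewrite Nat.sub_succ_r. eapply ev_primS; [exact IHy|].
      eapply ev_comp; [|apply ev_pred]. ev. }
  eapply ev_comp; [|exact H]. ev.
Qed.

(** Triangular numbers, in the recursor form to which [Cantor.to_nat] unfolds, so that [to_nat_tri]
    holds by conversion. *)
Definition tri (n : nat) : nat := nat_rec _ 0%nat (fun i m => (S i + m)%nat) n.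

Lemma ev_tri x : eval r_tri [x] (tri x).
Proof.
  induction x; [apply ev_prim0; ev|].
  eapply ev_primS; [exact IHx|].
  eapply ev_comp; [|apply ev_add]. ev.
Qed.

Lemma to_nat_tri x y : Cantor.to_nat (x, y) = (y + tri (y + x))%nat.
Proof. reflexivity. Qed.

Lemma ev_pair x y : eval r_pair [x; y] (Cantor.to_nat (x, y)).
Proof.
  rewrite to_nat_tri.
  eapply ev_comp; [|apply ev_add].
  eapply evs_cons; [apply (ev_proj 1); simpl; lia|].
  eapply evs_cons; [|apply evs_nil].
  eapply ev_comp; [|apply ev_tri].
  eapply evs_cons; [|apply evs_nil].
  eapply ev_comp; [|apply ev_add]. ev.
Qed.

(** The Cantor diagonal on which [n] lies. Both projections follow from it by truncated subtraction,
    so it is the only part of unpairing that needs a recursion. *)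
Definition csum (n : nat) : nat :=
  (fst (Cantor.of_nat n) + snd (Cantor.of_nat n))%nat.

Lemma snd_of_nat_tri n : snd (Cantor.of_nat n) = (n - tri (csum n))%nat.
Proof.
  unfold csum. destruct (Cantor.of_nat n) as [x y] eqn:E; simpl.
  assert (H : n = Cantor.to_nat (x, y)) by (rewrite <- E; symmetry; apply Cantor.cancel_to_of).
  rewrite to_nat_tri, (Nat.add_comm y x) in H. lia.
Qed.

Lemma fst_of_nat_tri n : fst (Cantor.of_nat n) = (csum n - snd (Cantor.of_nat n))%nat.
Proof. unfold csum; lia. Qed.

(** The diagonal increases exactly when the first component is zero. The innermost differences
    compute that component, and truncated subtraction from 1 tests it for zero. *)
Lemma csum_S n :
  csum (S n) = (csum n + (1 - (csum n - (n - tri (csum n)))))%nat.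
Proof.
  rewrite <- snd_of_nat_tri, <- fst_of_nat_tri.
  unfold csum.
  change (Cantor.of_nat (S n)) with
    (let '(x, y) := Cantor.of_nat n in
     match x with 0%nat => (S y, 0%nat) | S x => (x, S y) end).
  destruct (Cantor.of_nat n) as [[|x] y]; simpl; lia.
Qed.

Definition r_sum : recf :=
  Rprim Rzero (Rcomp r_add [Rproj 1; Rcomp r_sub [Rcomp Rsucc [Rcomp Rzero []];
    Rcomp r_sub [Rproj 1; Rcomp r_sub [Rproj 0; Rcomp r_tri [Rproj 1]]]]]).
Definition r_snd : recf := Rcomp r_sub [Rproj 0; Rcomp r_tri [r_sum]].
Definition r_fst : recf := Rcomp r_sub [r_sum; r_snd].

Lemma ev_sum n : eval r_sum [n] (csum n).
Proof.
  induction n; [apply ev_prim0; ev|].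
  rewrite csum_S. eapply ev_primS; [exact IHn|].
  eapply ev_comp; [|apply ev_add].
  eapply evs_cons; [apply (ev_proj 1); simpl; lia|].
  eapply evs_cons; [|apply evs_nil].
  eapply ev_comp; [|apply ev_sub].
  eapply evs_cons; [ev|].
  eapply evs_cons; [|apply evs_nil].
  eapply ev_comp; [|apply ev_sub].
  eapply evs_cons; [apply (ev_proj 1); simpl; lia|].
  eapply evs_cons; [|apply evs_nil].
  eapply ev_comp; [|apply ev_sub].
  eapply evs_cons; [apply (ev_proj 0); simpl; lia|].
  eapply evs_cons; [|apply evs_nil].
  eapply ev_comp; [|apply ev_tri]. ev.
Qed.

Lemma ev_snd n : eval r_snd [n] (snd (Cantor.of_nat n)).
Proof.
  rewrite snd_of_nat_tri.
  eapply ev_comp; [|apply ev_sub].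
  eapply evs_cons; [apply (ev_proj 0); simpl; lia|].
  eapply evs_cons; [|apply evs_nil].
  eapply ev_comp; [|apply ev_tri].
  eapply evs_cons; [apply ev_sum|apply evs_nil].
Qed.

Lemma ev_fst n : eval r_fst [n] (fst (Cantor.of_nat n)).
Proof.
  rewrite fst_of_nat_tri.
  eapply ev_comp; [|apply ev_sub].
  eapply evs_cons; [apply ev_sum|].
  eapply evs_cons; [apply ev_snd|apply evs_nil].
Qed.

(** * Computable functions between encoded types *)

Class Enc (A : Type) := enc : A -> nat.
#[global] Instance enc_nat : Enc nat := fun x => x.
#[global] Instance enc_bool : Enc bool := Nat.b2n.
#[global] Instance enc_prod A B (EA : Enc A) (EB : Enc B) : Enc (A * B) :=
  fun p => Cantor.to_nat (enc (fst p), enc (snd p)).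

Definition comp {A B} {EA : Enc A} {EB : Enc B} (f : A -> B) : Prop :=
  exists e, forall a, eval e [enc a] (enc (f a)).

Section Closure.
Context {X Y Z : Type} {EX : Enc X} {EY : Enc Y} {EZ : Enc Z}.

Lemma comp_ext (f g : X -> Y) : (forall x, f x = g x) -> comp f -> comp g.
Proof. intros E [e H]; exists e; intros a; rewrite <- E; apply H. Qed.

Lemma comp_id : comp (fun x : X => x).
Proof. exists (Rproj 0); intros; ev. Qed.

Lemma comp_o (g : Y -> Z) (f : X -> Y) : comp g -> comp f -> comp (fun x => g (f x)).
Proof.
  intros [eg Hg] [ef Hf]; exists (Rcomp eg [ef]); intros a.
  eapply ev_comp; [|apply Hg]. eapply evs_cons; [apply Hf|apply evs_nil].
Qed.

Lemma comp_const (y : Y) : comp (fun _ : X => y).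
Proof.
  unfold comp. generalize (enc y) as n; intros n.
  exists (Nat.iter n (fun e => Rcomp Rsucc [e]) (Rcomp Rzero [])).
  intros a; induction n; simpl; ev.
Qed.

Lemma comp_pair (f : X -> Y) (g : X -> Z) :
  comp f -> comp g -> comp (fun x => (f x, g x)).
Proof.
  intros [ef Hf] [eg Hg]; exists (Rcomp r_pair [ef; eg]); intros a.
  eapply ev_comp; [|apply ev_pair].
  eapply evs_cons; [apply Hf|]. eapply evs_cons; [apply Hg|apply evs_nil].
Qed.

Lemma comp_fst (f : X -> Y * Z) : comp f -> comp (fun x => fst (f x)).
Proof.
  intros [ef Hf]; exists (Rcomp r_fst [ef]); intros a.
  eapply ev_comp; [eapply evs_cons; [apply Hf|apply evs_nil]|].
  unfold enc at 1, enc_prod.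
  pose proof (ev_fst (Cantor.to_nat (enc (fst (f a)), enc (snd (f a))))) as H.
  rewrite Cantor.cancel_of_to in H. exact H.
Qed.

Lemma comp_snd (f : X -> Y * Z) : comp f -> comp (fun x => snd (f x)).
Proof.
  intros [ef Hf]; exists (Rcomp r_snd [ef]); intros a.
  eapply ev_comp; [eapply evs_cons; [apply Hf|apply evs_nil]|].
  unfold enc at 1, enc_prod.
  pose proof (ev_snd (Cantor.to_nat (enc (fst (f a)), enc (snd (f a))))) as H.
  rewrite Cantor.cancel_of_to in H. exact H.
Qed.

Lemma comp_rec (c : X -> nat) (a : X -> Y) (g : X -> nat -> Y -> Y) :
  comp c -> comp a -> comp (fun z : X * (nat * Y) => g (fst z) (fst (snd z)) (snd (snd z))) ->
  comp (fun x => nat_rect (fun _ => Y) (a x) (g x) (c x)).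
Proof.
  intros [ec Hc] [ea Ha] [eg Hg].
  (* [Rprim] supplies the counter, the previous value and the parameter in this order; they are
     repacked as parameter, counter, value. *)
  exists (Rcomp (Rprim ea (Rcomp eg [Rcomp r_pair [Rproj 2; Rcomp r_pair [Rproj 0; Rproj 1]]]))
     [ec; Rproj 0]).
  intros x. eapply ev_comp.
  - eapply evs_cons; [apply Hc|]. ev.
  - simpl. unfold enc at 1, enc_nat. induction (c x) as [|n IH]; [apply ev_prim0, Ha|].
    eapply ev_primS; [exact IH|].
    eapply ev_comp; [|apply (Hg (x, (n, nat_rect (fun _ => Y) (a x) (g x) n)))].
    eapply evs_cons; [|apply evs_nil].
    eapply ev_comp; [|apply ev_pair].
    eapply evs_cons; [apply (ev_proj 2); simpl; lia|].
    eapply evs_cons; [|apply evs_nil].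
    eapply ev_comp; [|apply ev_pair]. ev.
Qed.

Lemma comp_if (b : X -> bool) (f g : X -> Y) :
  comp b -> comp f -> comp g -> comp (fun x => if b x then f x else g x).
Proof.
  intros [eb Hb] [ef Hf] [eg Hg].
  exists (Rcomp (Rprim eg (Rcomp ef [Rproj 2])) [eb; Rproj 0]).
  intros x. eapply ev_comp.
  - eapply evs_cons; [apply Hb|]. ev.
  - simpl. unfold enc at 1, enc_bool. destruct (b x); simpl.
    + eapply ev_primS; [apply ev_prim0; apply Hg|].
      eapply ev_comp; [|apply Hf]. ev.
    + apply ev_prim0, Hg.
Qed.

Lemma comp_of_nat (f : X -> nat) : comp f -> comp (fun x => Cantor.of_nat (f x)).
Proof.
  intros [e H]; exists e; intros a. unfold enc at 2, enc_prod.
  unfold enc at 2 3, enc_nat.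
  rewrite <- surjective_pairing, Cantor.cancel_to_of. apply H.
Qed.

Lemma comp_to_nat (f : X -> nat * nat) : comp f -> comp (fun x => Cantor.to_nat (f x)).
Proof.
  intros [e H]; exists e; intros a. specialize (H a).
  unfold enc at 2, enc_prod in H. unfold enc at 2 3, enc_nat in H.
  rewrite <- surjective_pairing in H. exact H.
Qed.

End Closure.

Section Arithmetic.
Context {X : Type} {EX : Enc X}.

Lemma comp_S (f : X -> nat) : comp f -> comp (fun x => S (f x)).
Proof. intros [e H]; exists (Rcomp Rsucc [e]); intros a; eapply ev_comp; [eapply evs_cons;
  [apply H|apply evs_nil]|apply ev_succ]. Qed.

Lemma comp_add (f g : X -> nat) : comp f -> comp g -> comp (fun x => (f x + g x)%nat).
Proof.
  intros [e H] [e' H']; exists (Rcomp r_add [e; e']); intros a.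
  eapply ev_comp; [|apply ev_add].
  eapply evs_cons; [apply H|eapply evs_cons; [apply H'|apply evs_nil]].
Qed.

Lemma comp_sub (f g : X -> nat) : comp f -> comp g -> comp (fun x => (f x - g x)%nat).
Proof.
  intros [e H] [e' H']; exists (Rcomp r_sub [e; e']); intros a.
  eapply ev_comp; [|apply ev_sub].
  eapply evs_cons; [apply H|eapply evs_cons; [apply H'|apply evs_nil]].
Qed.

Lemma comp_pred (f : X -> nat) : comp f -> comp (fun x => pred (f x)).
Proof.
  intros H. apply (comp_ext (fun x => (f x - 1)%nat)); [intros; lia|].
  apply comp_sub; [exact H | apply comp_const].
Qed.

Lemma comp_leb (f g : X -> nat) : comp f -> comp g -> comp (fun x => (f x <=? g x)%nat).
Proof.
  intros H H'.
  apply (comp_ext (fun x => nat_rect (fun _ => bool) true (fun _ _ => false) (f x - g x)%nat)).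
  - intros x. destruct (Nat.leb_spec (f x) (g x)) as [L|L].
    + replace (f x - g x)%nat with 0%nat by lia. reflexivity.
    + destruct (f x - g x)%nat eqn:E; [lia|reflexivity].
  - apply (comp_rec (fun x => (f x - g x)%nat) (fun _ => true) (fun _ _ _ => false));
      [apply comp_sub; assumption | apply comp_const | apply comp_const].
Qed.

Lemma comp_andb (f g : X -> bool) : comp f -> comp g -> comp (fun x => f x && g x)%bool.
Proof.
  intros H H'. apply (comp_ext (fun x => if f x then g x else false)); [intros x;
    destruct (f x); reflexivity|].
  apply comp_if; [exact H | exact H' | apply comp_const].
Qed.

Lemma comp_orb (f g : X -> bool) : comp f -> comp g -> comp (fun x => f x || g x)%bool.
Proof.
  intros H H'. apply (comp_ext (fun x => if f x then true else g x)); [intros x;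
    destruct (f x); reflexivity|].
  apply comp_if; [exact H | apply comp_const | exact H'].
Qed.

Lemma comp_negb (f : X -> bool) : comp f -> comp (fun x => negb (f x)).
Proof. intros H. apply (comp_if f (fun _ => false) (fun _ => true));
  [exact H | apply comp_const | apply comp_const]. Qed.

End Arithmetic.

Ltac ctac_step :=
  match goal with
  | H : comp ?f |- comp ?f => exact H
  | |- comp (fun x => x) => apply comp_id
  | |- comp (fun _ => ?c) => apply comp_const
  | |- comp (fun x => S _) => apply comp_S
  | |- comp (fun x => pred _) => apply comp_pred
  | |- comp (fun x => (_ + _)%nat) => apply comp_add
  | |- comp (fun x => (_ - _)%nat) => apply comp_sub
  | |- comp (fun x => (_ <=? _)%nat) => apply comp_leb
  | |- comp (fun x => (_ && _)%bool) => apply comp_andb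
  | |- comp (fun x => (_ || _)%bool) => apply comp_orb
  | |- comp (fun x => negb _) => apply comp_negb
  | |- comp (fun x => if _ then _ else _) => apply comp_if
  | |- comp (fun x => (_, _)) => apply comp_pair
  | |- comp fst => apply (comp_fst (fun x => x))
  | |- comp snd => apply (comp_snd (fun x => x))
  | |- comp (fun x => fst _) => apply comp_fst
  | |- comp (fun x => snd _) => apply comp_snd
  | |- comp (fun x => Cantor.of_nat _) => apply comp_of_nat
  | |- comp (fun x => Cantor.to_nat _) => apply comp_to_nat
  | |- comp (fun x => nat_rect _ _ _ _) => apply comp_rec
  | H : comp ?f |- comp (fun x => ?f _) => apply (comp_o f); [exact H|]
  end.
Ltac ctac := repeat (cbv beta; ctac_step).

(** * Bounded quantifiers and bounded search *)

Definition exists_lt (B : nat) (P : nat -> bool) : bool :=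
  nat_rect (fun _ => bool) false (fun m y => if P m then true else y) B.
Definition forall_lt (B : nat) (P : nat -> bool) : bool :=
  nat_rect (fun _ => bool) true (fun m y => if P m then y else false) B.
(** The least [m < B] with [P m], or [B] if there is none: the accumulator is the current candidate
    and stops moving once [P] holds of it. *)
Definition find_lt (B : nat) (P : nat -> bool) : nat :=
  nat_rect (fun _ => nat) 0%nat (fun m y => if P y then y else S m) B.

Lemma exists_lt_spec B P : exists_lt B P = true <-> exists m, (m < B)%nat /\ P m = true.
Proof.
  induction B as [|B IH]; simpl.
  - split; [discriminate | intros (m & ? & _); lia].
  - destruct (P B) eqn:E.
    + split; [exists B; auto | reflexivity].
    + fold (exists_lt B P). rewrite IH. split.
      * intros (m & L & H); exists m; auto.
      * intros (m & L & H); exists m; split; [|exact H].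
        destruct (Nat.eq_dec m B); [subst; congruence | lia].
Qed.

Lemma forall_lt_spec B P : forall_lt B P = true <-> forall m, (m < B)%nat -> P m = true.
Proof.
  induction B as [|B IH]; simpl.
  - split; [intros; lia | reflexivity].
  - fold (forall_lt B P). destruct (P B) eqn:E.
    + rewrite IH. split; [|auto].
      intros H m L. destruct (Nat.eq_dec m B); [subst; auto | apply H; lia].
    + split; [discriminate|]. intros H. rewrite H in E; [discriminate | lia].
Qed.

Lemma find_lt_spec B P :
  (find_lt B P <= B)%nat /\ (forall m, (m < find_lt B P)%nat -> P m = false) /\
  ((find_lt B P < B)%nat -> P (find_lt B P) = true).
Proof.
  unfold find_lt. induction B as [|B IH]; simpl; [repeat split; intros; lia|].
  destruct IH as (L & H1 & H2).
  set (w := nat_rect _ _ _ B) in *. destruct (P w) eqn:E; [repeat split; auto|].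
  assert (F : w = B).
  { destruct (Nat.eq_dec w B) as [|N]; [assumption|].
    enough (false = true) by discriminate. apply H2; lia. }
  clearbody w; subst w. repeat split; [lia| |lia].
  intros m Lm. destruct (Nat.eq_dec m B); [subst; auto | apply H1; lia].
Qed.

Lemma exists_lt_ext B P P' :
  (forall m, (m < B)%nat -> P m = P' m) -> exists_lt B P = exists_lt B P'.
Proof.
  unfold exists_lt. induction B as [|B IH]; simpl; intros E; [reflexivity|].
  rewrite (E B), IH; auto.
Qed.

Lemma forall_lt_ext B P P' :
  (forall m, (m < B)%nat -> P m = P' m) -> forall_lt B P = forall_lt B P'.
Proof.
  unfold forall_lt. induction B as [|B IH]; simpl; intros E; [reflexivity|].
  rewrite (E B), IH; auto.
Qed.

Lemma div2_S n : Nat.div2 (S n) = if Nat.even n then Nat.div2 n else S (Nat.div2 n).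
Proof.
  destruct (Nat.even n) eqn:E.
  - apply Nat.even_spec in E. destruct E as [k ->].
    rewrite Nat.div2_succ_double, Nat.div2_double. reflexivity.
  - assert (O : Nat.odd n = true) by (rewrite <- Nat.negb_even, E; reflexivity).
    apply Nat.odd_spec in O. destruct O as [k ->].
    replace (2*k+1)%nat with (S (2*k)) by lia.
    rewrite Nat.div2_succ_double. replace (S (S (2*k))) with (2 * S k)%nat by lia.
    apply Nat.div2_double.
Qed.

Section Search.
Context {X : Type} {EX : Enc X}.

Lemma comp_exists_lt (B : X -> nat) (P : X -> nat -> bool) :
  comp B -> comp (fun z : X * nat => P (fst z) (snd z)) -> comp (fun x => exists_lt (B x) (P x)).
Proof.
  intros HB HP. unfold exists_lt.
  apply (comp_rec B (fun _ => false) (fun x m y => if P x m then true else y)); ctac.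
  apply (comp_o (fun z : X * nat => P (fst z) (snd z)) (fun z :
    X * (nat * bool) => (fst z, fst (snd z)))); ctac.
Qed.

Lemma comp_forall_lt (B : X -> nat) (P : X -> nat -> bool) :
  comp B -> comp (fun z : X * nat => P (fst z) (snd z)) -> comp (fun x => forall_lt (B x) (P x)).
Proof.
  intros HB HP. unfold forall_lt.
  apply (comp_rec B (fun _ => true) (fun x m y => if P x m then y else false)); ctac.
  apply (comp_o (fun z : X * nat => P (fst z) (snd z)) (fun z :
    X * (nat * bool) => (fst z, fst (snd z)))); ctac.
Qed.

Lemma comp_find_lt (B : X -> nat) (P : X -> nat -> bool) :
  comp B -> comp (fun z : X * nat => P (fst z) (snd z)) -> comp (fun x => find_lt (B x) (P x)).
Proof.
  intros HB HP. unfold find_lt.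
  apply (comp_rec B (fun _ => 0%nat) (fun x m y => if P x y then y else S m)); ctac.
  apply (comp_o (fun z : X * nat => P (fst z) (snd z)) (fun z :
    X * (nat * nat) => (fst z, snd (snd z)))); ctac.
Qed.

Lemma comp_mul (f g : X -> nat) : comp f -> comp g -> comp (fun x => (f x * g x)%nat).
Proof.
  intros Hf Hg.
  apply (comp_ext (fun x => nat_rect (fun _ => nat) 0%nat (fun _ y => (g x + y)%nat) (f x))).
  - intros x. induction (f x) as [|n IH]; simpl; [|rewrite IH]; reflexivity.
  - apply (comp_rec f (fun _ => 0%nat) (fun x _ y => (g x + y)%nat)); ctac.
Qed.

Lemma comp_even (f : X -> nat) : comp f -> comp (fun x => Nat.even (f x)).
Proof.
  intros H. apply (comp_ext (fun x => nat_rect (fun _ => bool) true (fun _ b => negb b) (f x))).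
  - intros x. induction (f x) as [|n IH]; [reflexivity|].
    rewrite Nat.even_succ, <- Nat.negb_even, <- IH. reflexivity.
  - apply (comp_rec f (fun _ => true) (fun _ _ b => negb b)); ctac.
Qed.

End Search.

Lemma comp_div2 {X} {EX : Enc X} (f : X -> nat) : comp f -> comp (fun x => Nat.div2 (f x)).
Proof.
  intros H. apply (comp_ext (fun x => nat_rect (fun _ => nat) 0%nat
      (fun m h => if Nat.even m then h else S h) (f x))).
  - intros x. induction (f x) as [|n IH]; [reflexivity|].
    rewrite div2_S, <- IH. reflexivity.
  - apply (comp_rec f (fun _ => 0%nat) (fun _ m h => if Nat.even m then h else S h)); ctac.
    apply comp_even; ctac.
Qed.

(** * Fractions and code lists *)

Notation frac := (nat * nat * nat)%type.

(* [((a, b), c)] denotes [(a - b) / (c + 1)]. *)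
Definition val (f : frac) : R :=
  (INR (fst (fst f)) - INR (snd (fst f))) / INR (S (snd f)).

Definition f_nat (k : nat) : frac := ((k, 0), 0)%nat.
Definition f_inv (m : nat) : frac := ((1, 0), m)%nat.
Definition f_opp (f : frac) : frac := ((snd (fst f), fst (fst f)), snd f).
Definition f_add (f g : frac) : frac :=
  ((fst (fst f) * S (snd g) + fst (fst g) * S (snd f),
    snd (fst f) * S (snd g) + snd (fst g) * S (snd f)),
   pred (S (snd f) * S (snd g)))%nat.
Definition f_mul (f g : frac) : frac :=
  ((fst (fst f) * fst (fst g) + snd (fst f) * snd (fst g),
    fst (fst f) * snd (fst g) + snd (fst f) * fst (fst g)),
   pred (S (snd f) * S (snd g)))%nat.
Definition f_abs (f : frac) : frac :=
  (((fst (fst f) - snd (fst f)) + (snd (fst f) - fst (fst f)), 0), snd f)%nat.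
Definition f_le (f g : frac) : bool :=
  (fst (fst f) * S (snd g) + snd (fst g) * S (snd f) <=?
   fst (fst g) * S (snd f) + snd (fst f) * S (snd g))%nat.
Definition frac_of (k : nat) : frac :=
  (if Nat.even (fst (Cantor.of_nat k))
   then (Nat.div2 (fst (Cantor.of_nat k)), 0%nat)
   else (0%nat, S (Nat.div2 (fst (Cantor.of_nat k)))), snd (Cantor.of_nat k)).
(** The squared Euclidean distance, which stays rational at rational points. *)
Fixpoint f_dsq (n : nat) (f g : nat -> frac) : frac :=
  match n with
  | O => f_nat 0
  | S m => f_add (f_dsq m f g)
                 (f_mul (f_add (f m) (f_opp (g m))) (f_add (f m) (f_opp (g m))))
  end.
(* The boolean form of [sqrt D <= rho]. *)
Definition f_near (D rho : frac) : bool :=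
  (f_le (f_nat 0) rho && f_le D (f_mul rho rho))%bool.

Section FracComp.
Context {X : Type} {EX : Enc X}.

Lemma comp_f_nat (k : X -> nat) : comp k -> comp (fun x => f_nat (k x)).
Proof. intros; unfold f_nat; ctac. Qed.
Lemma comp_f_inv (k : X -> nat) : comp k -> comp (fun x => f_inv (k x)).
Proof. intros; unfold f_inv; ctac. Qed.
Lemma comp_f_opp (f : X -> frac) : comp f -> comp (fun x => f_opp (f x)).
Proof. intros; unfold f_opp; ctac. Qed.
Lemma comp_f_add (f g : X -> frac) : comp f -> comp g -> comp (fun x => f_add (f x) (g x)).
Proof. intros; unfold f_add; ctac; apply comp_mul; ctac. Qed.
Lemma comp_f_mul (f g : X -> frac) : comp f -> comp g -> comp (fun x => f_mul (f x) (g x)).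
Proof. intros; unfold f_mul; ctac; apply comp_mul; ctac. Qed.
Lemma comp_f_abs (f : X -> frac) : comp f -> comp (fun x => f_abs (f x)).
Proof. intros; unfold f_abs; ctac. Qed.
Lemma comp_f_le (f g : X -> frac) : comp f -> comp g -> comp (fun x => f_le (f x) (g x)).
Proof. intros; unfold f_le; ctac; apply comp_mul; ctac. Qed.
Lemma comp_frac_of (k : X -> nat) : comp k -> comp (fun x => frac_of (k x)).
Proof. intros; unfold frac_of; ctac; first [apply comp_even | apply comp_div2]; ctac. Qed.
Lemma comp_f_dsq n (f g : X -> nat -> frac) :
  (forall i, comp (fun x => f x i)) -> (forall i, comp (fun x => g x i)) ->
  comp (fun x => f_dsq n (f x) (g x)).
Proof.
  intros Hf Hg. induction n as [|n IH]; simpl; [ctac|].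
  apply comp_f_add; [exact IH|].
  assert (comp (fun x => f_add (f x n) (f_opp (g x n)))) by
    (apply comp_f_add; [apply Hf | apply comp_f_opp, Hg]).
  apply comp_f_mul; assumption.
Qed.
Lemma comp_f_near (f g : X -> frac) : comp f -> comp g -> comp (fun x => f_near (f x) (g x)).
Proof.
  intros; unfold f_near; ctac; apply comp_f_le; ctac. apply comp_f_mul; ctac.
Qed.

End FracComp.

Lemma val_f_nat k : val (f_nat k) = INR k.
Proof. unfold val; simpl. lra. Qed.
Lemma val_f_inv m : val (f_inv m) = / INR (S m).
Proof. unfold val, f_inv, fst, snd. simpl (INR 1). simpl (INR 0). unfold Rdiv. lra. Qed.
Lemma INR_S_neq0 m : INR (S m) <> 0.
Proof. apply not_0_INR. lia. Qed.
Lemma INR_S_pos m : 0 < INR (S m).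
Proof. apply lt_0_INR. lia. Qed.
Lemma val_f_opp f : val (f_opp f) = - val f.
Proof. unfold val, f_opp, fst, snd; destruct f as [[a b] c]. field. apply INR_S_neq0. Qed.
Lemma val_f_add f g : val (f_add f g) = val f + val g.
Proof.
  unfold val, f_add, fst, snd; destruct f as [[a b] c], g as [[a' b'] c'].
  rewrite Nat.succ_pred by lia. rewrite !plus_INR, !mult_INR. field.
  split; apply INR_S_neq0.
Qed.
Lemma val_f_mul f g : val (f_mul f g) = val f * val g.
Proof.
  unfold val, f_mul, fst, snd; destruct f as [[a b] c], g as [[a' b'] c'].
  rewrite Nat.succ_pred by lia. rewrite !plus_INR, !mult_INR. field.
  split; apply INR_S_neq0.
Qed.
Lemma val_f_abs f : val (f_abs f) = Rabs (val f).
Proof.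
  unfold val, f_abs, fst, snd; destruct f as [[a b] c].
  unfold Rdiv. rewrite Rabs_mult, (Rabs_pos_eq (/ _)) by (left;
    apply Rinv_0_lt_compat, INR_S_pos).
  f_equal. simpl (INR 0). destruct (le_lt_dec a b) as [L|L].
  - replace (a - b + (b - a))%nat with (b - a)%nat by lia. rewrite minus_INR by lia.
    apply le_INR in L. rewrite Rabs_minus_sym, Rabs_pos_eq; lra.
  - replace (a - b + (b - a))%nat with (a - b)%nat by lia. rewrite minus_INR by lia.
    apply lt_INR in L. rewrite Rabs_pos_eq; lra.
Qed.
Lemma f_le_spec f g : f_le f g = true <-> val f <= val g.
Proof.
  unfold f_le, val; destruct f as [[a b] c], g as [[a' b'] c']; cbn [fst snd].
  rewrite Nat.leb_le.
  pose proof (INR_S_pos c) as P. pose proof (INR_S_pos c') as P'.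
  set (u := INR (S c)) in *. set (v := INR (S c')) in *.
  assert (E : (INR a' - INR b') / v - (INR a - INR b) / u =
     ((INR a' * u + INR b * v) - (INR a * v + INR b' * u)) * / (u * v)) by (field; lra).
  assert (K : 0 < / (u * v)) by (apply Rinv_0_lt_compat; nra).
  split; intros H.
  - apply le_INR in H. rewrite !plus_INR, !mult_INR in H. fold u v in H. nra.
  - apply INR_le. rewrite !plus_INR, !mult_INR. fold u v.
    apply Rnot_lt_le; intros C. nra.
Qed.

Lemma val_frac_of k : val (frac_of k) = Q2R (nu_Q k).
Proof.
  unfold frac_of, nu_Q, nu_Z, val. destruct (Cantor.of_nat k) as [a b]; cbn [fst snd].
  unfold Q2R; cbn [Qnum Qden]. unfold Rdiv. f_equal.
  - destruct (Nat.even a); cbn [fst snd].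
    + rewrite <- INR_IZR_INZ. simpl; lra.
    + rewrite opp_IZR, <- INR_IZR_INZ. simpl (INR 0). lra.
  - f_equal. rewrite INR_IZR_INZ. reflexivity.
Qed.

(** * Access to coded lists and quantification over grids *)

Definition c_tl (i z : nat) : nat :=
  nat_rect (fun _ => nat) z (fun _ y => snd (Cantor.of_nat (pred y))) i.
(** Beyond the end the remaining code is 0, and [pred 0] unpairs to zeros, which agrees with the
    default of [nth]. *)
Definition c_nth (i z : nat) : nat := fst (Cantor.of_nat (pred (c_tl i z))).

Lemma comp_c_tl {X} {EX : Enc X} (i z : X -> nat) :
  comp i -> comp z -> comp (fun x => c_tl (i x) (z x)).
Proof.
  intros. unfold c_tl.
  apply (comp_rec i z (fun _ _ y => snd (Cantor.of_nat (pred y)))); ctac.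
Qed.
Lemma comp_c_nth {X} {EX : Enc X} (i z : X -> nat) :
  comp i -> comp z -> comp (fun x => c_nth (i x) (z x)).
Proof. intros. unfold c_nth. ctac. apply comp_c_tl; ctac. Qed.

Lemma c_tl_code i l : c_tl i (code_list l) = code_list (skipn i l).
Proof.
  induction i as [|i IH]; [reflexivity|].
  change (c_tl (S i) (code_list l)) with (snd (Cantor.of_nat (pred (c_tl i (code_list l))))).
  rewrite IH. replace (S i) with (1 + i)%nat by lia. rewrite <- skipn_skipn.
  destruct (skipn i l) as [|x l']; [reflexivity|].
  cbn [code_list pred]. rewrite Cantor.cancel_of_to. reflexivity.
Qed.

Lemma c_nth_code i l : c_nth i (code_list l) = nth i l 0%nat.
Proof.
  unfold c_nth. rewrite c_tl_code. rewrite <- (Nat.add_0_r i) at 2. rewrite <- nth_skipn.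
  destruct (skipn i l) as [|x l']; [reflexivity|].
  cbn [code_list pred]. rewrite Cantor.cancel_of_to. reflexivity.
Qed.

Lemma decode_code_aux l : forall fuel, (code_list l <= fuel)%nat ->
  decode_aux fuel (code_list l) = l.
Proof.
  induction l as [|x l IH]; intros fuel H; destruct fuel as [|fuel];
    try reflexivity; cbn [code_list] in H; [lia|].
  cbn [code_list decode_aux]. rewrite Cantor.cancel_of_to. f_equal. apply IH.
  pose proof (Cantor.to_nat_non_decreasing x (code_list l)). lia.
Qed.

Lemma decode_code l : decode_list (code_list l) = l.
Proof. apply decode_code_aux. lia. Qed.

Lemma code_list_surj z : exists l, z = code_list l.
Proof.
  induction z as [z IH] using (well_founded_induction lt_wf).
  destruct z as [|z]; [exists []; reflexivity|].
  destruct (Cantor.of_nat z) as [x y] eqn:E.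
  assert (F : z = Cantor.to_nat (x, y)) by (rewrite <- E; symmetry; apply Cantor.cancel_to_of).
  pose proof (Cantor.to_nat_non_decreasing x y).
  destruct (IH y) as [l ->]; [lia|]. exists (x :: l). rewrite F. reflexivity.
Qed.

Lemma c_nth_decode i z : c_nth i z = nth i (decode_list z) 0%nat.
Proof. destruct (code_list_surj z) as [l ->]. rewrite decode_code. apply c_nth_code. Qed.

(** Allows the code of a prefix to serve as the bound of a search among all witnesses readable from
    that prefix. *)
Lemma length_le_code l : (length l <= code_list l)%nat.
Proof.
  induction l as [|x l IH]; [simpl; lia|]. cbn [length code_list].
  pose proof (Cantor.to_nat_non_decreasing x (code_list l)). lia.
Qed.

Definition c_longer (i z : nat) : bool := (1 <=? c_tl i z)%nat.

Lemma c_longer_code i l : c_longer i (code_list l) = true <-> (i < length l)%nat.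
Proof.
  unfold c_longer. rewrite Nat.leb_le, c_tl_code.
  pose proof (length_skipn i l) as L.
  destruct (skipn i l) as [|x l']; cbn [length code_list] in *; lia.
Qed.

Fixpoint forall_grid (n B : nat) (P : nat -> bool) : bool :=
  match n with
  | O => P 0%nat
  | S m => forall_lt B (fun u => forall_grid m B (fun z => P (S (Cantor.to_nat (u, z)))))
  end.

Lemma forall_grid_spec n B P :
  forall_grid n B P = true <->
  forall l, length l = n -> (forall u, In u l -> (u < B)%nat) -> P (code_list l) = true.
Proof.
  revert P; induction n as [|n IH]; intros P; simpl.
  - split; [intros H [|? ?]; [auto|discriminate] | intros H; apply (H []); simpl; tauto].
  - rewrite forall_lt_spec. split.
    + intros H [|u l] E K; [discriminate|]. simpl in E.
      apply (proj1 (IH (fun z => P (S (Cantor.to_nat (u, z))))) (H u (K u (or_introl eq_refl))));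
        [lia | intros; apply K; right; assumption].
    + intros H u L. apply IH. intros l E K. apply (H (u :: l)); [simpl; lia|].
      intros w [<-|W]; auto.
Qed.

Lemma forall_grid_ext n B P P' : (forall z, P z = P' z) -> forall_grid n B P = forall_grid n B P'.
Proof.
  revert P P'; induction n as [|n IH]; intros P P' E; simpl; [apply E|].
  apply forall_lt_ext; intros u _. apply IH; intros; apply E.
Qed.

(** The parameter type is quantified inside the induction, since each dimension adds the coordinate
    already chosen to the parameters. *)
Lemma comp_forall_grid n : forall X (EX : Enc X) (B : X -> nat) (P : X -> nat -> bool),
  comp B -> comp (fun z : X * nat => P (fst z) (snd z)) ->
  comp (fun x => forall_grid n (B x) (P x)).
Proof.
  induction n as [|n IH]; intros X EX B P HB HP; simpl.
  - apply (comp_o (fun z : X * nat => P (fst z) (snd z)) (fun x => (x, 0%nat))); ctac.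
  - apply (comp_forall_lt B (fun x u => forall_grid n (B x) (fun z => P x (S (Cantor.to_nat (u,
      z))))));
      [exact HB|].
    apply (IH (X * nat)%type _ (fun x => B (fst x))
             (fun x z => P (fst x) (S (Cantor.to_nat (snd x, z))))); [ctac|].
    apply (comp_o (fun z : X * nat => P (fst z) (snd z))
             (fun z : (X * nat) * nat =>
                (fst (fst z), S (Cantor.to_nat (snd (fst z), snd z))))); ctac.
Qed.

(** * Euclidean distance and compactness of boxes *)

(** Distance on arbitrary sequences, looking at the first [n] coordinates only, so that grid points
    and limits need not be packed into [Rn]. *)
Definition dn (n : nat) (f g : nat -> R) : R := sqrt (sum_lt n (fun i => (f i - g i) ^ 2)).

Lemma sum_lt_nonneg n f : (forall i, 0 <= f i) -> 0 <= sum_lt n f.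
Proof. intros H; induction n; simpl; [lra|]. specialize (H n). lra. Qed.

Lemma sum_lt_ext n f g : (forall i, (i < n)%nat -> f i = g i) -> sum_lt n f = sum_lt n g.
Proof. intros H; induction n; simpl; [lra|]. rewrite IHn, H by auto. reflexivity. Qed.

Lemma dsq_nonneg n f g : 0 <= sum_lt n (fun i => (f i - g i) ^ 2).
Proof. apply sum_lt_nonneg; intros; apply pow2_ge_0. Qed.

Lemma dn_nonneg n f g : 0 <= dn n f g.
Proof. apply sqrt_pos. Qed.

Lemma dn_ext n f f' g g' :
  (forall i, (i < n)%nat -> f i = f' i) -> (forall i, (i < n)%nat -> g i = g' i) ->
  dn n f g = dn n f' g'.
Proof. intros H H'. unfold dn. f_equal. apply sum_lt_ext; intros. rewrite H, H'; auto. Qed.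

Lemma dn_S n f g : dn (S n) f g = sqrt (dn n f g ^ 2 + (f n - g n) ^ 2).
Proof. unfold dn. rewrite pow2_sqrt by apply dsq_nonneg. reflexivity. Qed.

Lemma dn_sym n f g : dn n f g = dn n g f.
Proof. unfold dn; f_equal. apply sum_lt_ext; intros; ring. Qed.

(** The induction step of the triangle inequality. Its core [K] is the Cauchy-Schwarz inequality in
    the plane, obtained from the square of [A * b - a * B]. *)
Lemma sqrt_sum_le A a B b C :
  0 <= A -> 0 <= B -> 0 <= C -> C <= A + B ->
  sqrt (C ^ 2 + (a + b) ^ 2) <= sqrt (A ^ 2 + a ^ 2) + sqrt (B ^ 2 + b ^ 2).
Proof.
  intros HA HB HC H.
  assert (HP : 0 <= A ^ 2 + a ^ 2) by nra. assert (HQ : 0 <= B ^ 2 + b ^ 2) by nra.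
  pose proof (sqrt_pos (A ^ 2 + a ^ 2)) as P0. pose proof (sqrt_pos (B ^ 2 + b ^ 2)) as Q0.
  pose proof (pow2_sqrt _ HP) as P2. pose proof (pow2_sqrt _ HQ) as Q2.
  set (P := sqrt (A ^ 2 + a ^ 2)) in *. set (Q := sqrt (B ^ 2 + b ^ 2)) in *.
  assert (K : A * B + a * b <= P * Q).
  { apply Rnot_lt_le; intros L.
    assert (0 <= P * Q) by nra.
    assert ((P * Q) ^ 2 < (A * B + a * b) ^ 2) by nra.
    replace ((P * Q) ^ 2) with (P ^ 2 * Q ^ 2) in * by ring. rewrite P2, Q2 in *.
    pose proof (pow2_ge_0 (A * b - a * B)). nra. }
  rewrite <- (sqrt_pow2 (P + Q)) by lra. apply sqrt_le_1_alt.
  assert (C ^ 2 <= (A + B) ^ 2) by nra. nra.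
Qed.

Lemma dn_triangle n f g h : dn n f h <= dn n f g + dn n g h.
Proof.
  induction n as [|n IH].
  - unfold dn; simpl; rewrite sqrt_0; lra.
  - rewrite !dn_S. replace (f n - h n) with ((f n - g n) + (g n - h n)) by ring.
    apply sqrt_sum_le; auto using dn_nonneg.
Qed.

Lemma dn_refl n f : dn n f f = 0.
Proof.
  induction n as [|n IH]; [apply sqrt_0|]. rewrite dn_S, IH.
  replace (0 ^ 2 + (f n - f n) ^ 2) with 0 by ring. apply sqrt_0.
Qed.

Lemma coord_le_dn n f g i : (i < n)%nat -> Rabs (f i - g i) <= dn n f g.
Proof.
  intros L. induction n as [|n IH]; [lia|]. rewrite dn_S.
  pose proof (dn_nonneg n f g).
  destruct (Nat.eq_dec i n) as [->|N].
  - rewrite <- (sqrt_pow2 (Rabs _)) by apply Rabs_pos. apply sqrt_le_1_alt.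
    rewrite <- RPow_abs, pow2_abs || rewrite pow2_abs. nra.
  - apply Rle_trans with (dn n f g); [apply IH; lia|].
    rewrite <- (sqrt_pow2 (dn n f g)) at 1 by lra. apply sqrt_le_1_alt.
    pose proof (pow2_ge_0 (f n - g n)). lra.
Qed.

Lemma dn_le_coord n f g c :
  0 <= c -> (forall i, (i < n)%nat -> Rabs (f i - g i) <= c) -> dn n f g <= INR n * c.
Proof.
  intros Hc H. induction n as [|n IH]; [unfold dn; simpl; rewrite sqrt_0; lra|].
  rewrite dn_S, S_INR.
  assert (IH' : dn n f g <= INR n * c) by auto.
  pose proof (dn_nonneg n f g). pose proof (H n (Nat.lt_succ_diag_r n)) as Hn.
  pose proof (Rabs_pos (f n - g n)).
  rewrite <- (sqrt_pow2 ((INR n + 1) * c)) by (pose proof (pos_INR n); nra).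
  apply sqrt_le_1_alt. rewrite <- (pow2_abs (f n - g n)). nra.
Qed.

Lemma Rabs_le_inv a b : Rabs a <= b -> - b <= a <= b.
Proof. intros H. pose proof (Rle_abs a). pose proof (Rle_abs (- a)). rewrite Rabs_Ropp in *.
lra. Qed.

Lemma mono_le (P : nat -> Prop) :
  (forall m, P m -> P (S m)) -> forall m m', (m <= m')%nat -> P m -> P m'.
Proof. intros H m m' L; induction L; auto. Qed.

(** Heine-Borel by a supremum: [E] collects the [s] such that one index works on all of [[-M, s]]. A
    neighbourhood of the supremum overlaps such an initial segment, so one index works beyond the
    supremum, which is impossible unless [M] is already covered. *)
Lemma segment_compact (M : R) (P : nat -> R -> Prop) :
  (forall m t, P m t -> P (S m) t) ->
  (forall t, Rabs t <= M -> exists m d, 0 < d /\ forall t', Rabs (t' - t) < d -> P m t') ->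
  exists m, forall t, Rabs t <= M -> P m t.
Proof.
  intros mono loc.
  destruct (Rlt_le_dec M 0) as [N|N].
  { exists 0%nat; intros t Ht. pose proof (Rabs_pos t). lra. }
  set (E := fun s => - M <= s <= M /\ exists m, forall t, - M <= t <= s -> P m t).
  assert (E0 : E (- M)).
  { split; [lra|]. destruct (loc (- M)) as (m & d & Hd & H); [rewrite Rabs_Ropp, Rabs_pos_eq;
    lra|].
    exists m; intros t Ht. apply H. replace (t - - M) with 0 by lra. rewrite Rabs_R0; lra. }
  destruct (completeness E) as [s [ub lub]].
  { exists M; intros x [? _]; lra. }
  { exists (- M); exact E0. }
  assert (Hs : - M <= s <= M).
  { split; [apply ub, E0|]. apply lub; intros x [? _]; lra. }
  destruct (loc s) as (m & d & Hd & H); [apply Rabs_le; lra|].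
  assert (exists s', E s' /\ s - d < s') as (s' & [Hs' (m' & H')] & L').
  { apply NNPP; intros C.
    assert (s <= s - d); [|lra]. apply lub; intros x Hx.
    apply Rnot_lt_le; intros ?. apply C; exists x; split; auto. }
  assert (K : forall t, - M <= t < s + d -> P (max m m') t).
  { intros t Ht. destruct (Rle_lt_dec t s').
    - apply (mono_le (fun m => P m t)) with m'; [auto | lia | apply H'; lra].
    - apply (mono_le (fun m => P m t)) with m; [auto | lia | apply H; apply Rabs_def1; lra]. }
  exists (max m m'). intros t Ht. apply Rabs_le_inv in Ht. apply K. split; [lra|].
  apply Rnot_le_lt; intros C.
  assert (s + d / 2 <= s); [|lra]. apply ub. split; [lra|].
  exists (max m m'). intros; apply K; lra.
Qed.

Lemma inv_small (d : R) : 0 < d -> exists m, forall m', (m <= m')%nat -> / INR (S m') < d.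
Proof.
  intros H. destruct (archimed_cor1 d H) as (N & HN & Np). exists N; intros m' L.
  apply Rle_lt_trans with (/ INR N); [|exact HN].
  apply Rinv_le_contravar; [apply lt_0_INR; lia | apply le_INR; lia].
Qed.

(* Induction on the dimension: for a fixed last coordinate [t] the induction hypothesis
   gives a bound valid on a slab around the slice, and slabs are glued by
   compactness of the segment. *)
Lemma box_compact (M : R) (n : nat) : forall (P : nat -> (nat -> R) -> Prop),
  (forall m g, P m g -> P (S m) g) ->
  (forall g, (forall i, (i < n)%nat -> Rabs (g i) <= M) ->
     exists m d, 0 < d /\ forall g', (forall i, (i < n)%nat -> Rabs (g' i - g i) < d) ->
       P m g') ->
  exists m, forall g, (forall i, (i < n)%nat -> Rabs (g i) <= M) -> P m g.
Proof.
  induction n as [|n IH]; intros P mono loc.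
  - destruct (loc (fun _ => 0)) as (m & d & _ & H); [lia|]. exists m; intros; apply H; lia.
  - destruct (segment_compact M (fun m t =>
      forall g, (forall i, (i < n)%nat -> Rabs (g i) <= M) -> g n = t -> P m g)) as [m Hm].
    + intros; auto.
    + intros t Ht.
      (* The half-width of the slab is tied to the index as [/ INR (S m)], so that the single bound
         from the induction hypothesis controls both. *)
      destruct (IH (fun m h => forall g, (forall i, (i < n)%nat -> g i = h i) ->
                  Rabs (g n - t) < / INR (S m) -> P m g)) as [m Hm].
      * intros m h H g Hg L. apply mono, H; [exact Hg|].
        apply Rlt_le_trans with (1 := L).
        apply Rinv_le_contravar; [apply INR_S_pos | apply le_INR; lia].
      * intros h Hh.
        destruct (loc (fun i => if Nat.eqb i n then t else h i)) as (m & d & Hd & H).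
        { intros i Hi. destruct (Nat.eqb_spec i n); [exact Ht | apply Hh; lia]. }
        destruct (inv_small d Hd) as [m1 Hm1].
        exists (max m m1), d. split; [exact Hd|]. intros h' Hh' g Hg Lg.
        apply (mono_le (fun m => P m g)) with m; [auto | lia|].
        apply H. intros i Hi. destruct (Nat.eqb_spec i n) as [->|Ni].
        -- apply Rlt_trans with (1 := Lg). apply Hm1; lia.
        -- rewrite Hg by lia. apply Hh'; lia.
      * exists m, (/ INR (S m)). split; [apply Rinv_0_lt_compat, INR_S_pos|].
        intros t' Ht' g Hg Eg. apply (Hm g Hg g); [reflexivity | rewrite Eg; exact Ht'].
    + exists m; intros g Hg. apply (Hm (g n)); auto.
Qed.

(** * The algorithm *)

Section Algorithm.
(* [n] is the dimension and [1 / (N + 1)] a lower bound of the tolerance.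
   In an input [o], [o (2 * m)] is the [m]-th approximation of the point, [o (4 * j + 1)] the
   [j]-th ball of the complement and [o (4 * a + 3)] the [a]-th ball meeting the closed set.
   A search witness [w] codes [(a, (m, l))]; a state is [0] at the start and [S b] when the
   current ball is [b]. *)
Context (n N : nat).

Definition pt (c : nat) : nat -> frac := fun i => frac_of (c_nth i c).
Definition cen (b : nat) : nat := fst (Cantor.of_nat b).
Definition rad (b : nat) : frac := f_abs (frac_of (snd (Cantor.of_nat b))).

(** The grid has spacing [l / (m + 1)], so rounding in every coordinate costs at most [n] times
    this; the factor [n + 1] makes the bound strict for [l > 0]. *)
Definition mesh (m : nat) (l : frac) : frac := f_mul l ((S n, 0), m)%nat.
(** Entries of [z] from 0 to [2 * S m] give offsets from [- l] to [l]; the entry [S m] is the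
    centre. *)
Definition grid_pt (c m : nat) (l : frac) (z : nat) : nat -> frac :=
  fun i => f_add (pt c i) (f_mul l ((c_nth i z, S m), m)).

(* Certifies that the distance of the [m]-th approximation [c] of the input point to the
   closed set is at least [l]: the points [g] of a grid of width [2 l] around [c] are
   either far from [c], or so deep inside one of the first [m] complementary balls that
   the whole cell around [g] is in that ball. *)
Definition cert (o : nat -> nat) (m : nat) (l : frac) : bool :=
  forall_grid n (S (2 * S m)) (fun z =>
    negb (f_near (f_dsq n (grid_pt (o (2 * m)) m l z) (pt (o (2 * m))))
                 (f_add l (mesh m l))) ||
    exists_lt m (fun j =>
      f_near (f_dsq n (grid_pt (o (2 * m)) m l z) (pt (cen (o (4 * j + 1)))))
             (f_add (rad (o (4 * j + 1))) (f_opp (mesh m l)))))%nat%bool.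

(** The constants yield the Cauchy modulus: moves of at most 4 radii, with radii halved each time,
    sum to at most 8 radii. As the first radius is at most 1/16, all centres after the [i]-th lie
    within half of [/ 2 ^ i] of it. *)
Definition test_step (t b : nat) : bool :=
  if (t <=? 0)%nat then f_le (f_mul (f_nat 16) (rad b)) (f_nat 1)
  else (f_le (f_mul (f_nat 2) (rad b)) (rad (pred t)) &&
        f_near (f_dsq n (pt (cen b)) (pt (cen (pred t))))
               (f_mul (f_nat 4) (rad (pred t))))%bool.

(** The terms [f_inv m] absorb the error of the [m]-th approximation of the point, both in the
    distance to the centre and in [l], which is certified for the approximation rather than for the
    point. *)
Definition test_good (o : nat -> nat) (b m : nat) (l : frac) : bool :=
  (f_near (f_dsq n (pt (cen b)) (pt (o (2 * m)%nat))) (f_add (rad b) (f_opp (f_inv m))) ||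
   cert o m l &&
   f_near (f_dsq n (pt (cen b)) (pt (o (2 * m)%nat)))
     (f_add (f_mul (f_add (f_nat 1) (f_inv N)) (f_add l (f_opp (f_inv m))))
            (f_opp (f_add (rad b) (f_inv m)))))%bool.

Definition w_ball (w : nat) : nat := (4 * fst (Cantor.of_nat w) + 3)%nat.
Definition w_prec (w : nat) : nat := fst (Cantor.of_nat (snd (Cantor.of_nat w))).
Definition w_dist (w : nat) : frac :=
  f_abs (frac_of (snd (Cantor.of_nat (snd (Cantor.of_nat w))))).

Definition test (o : nat -> nat) (t w : nat) : bool :=
  (test_step t (o (w_ball w)) && test_good o (o (w_ball w)) (w_prec w) (w_dist w))%bool.

(* The first conjunct keeps the test from reading beyond the known prefix [z]. *)
Definition safe_test (z t w : nat) : bool :=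
  (c_longer (4 * w + 3) z && test (fun i => c_nth i z) t w)%bool.

Definition next_state (z t : nat) : nat :=
  if safe_test z t (find_lt z (safe_test z t))
  then S (c_nth (w_ball (find_lt z (safe_test z t))) z) else 0%nat.

(** A failed step returns 0, which is also the start state; it is propagated explicitly, since
    otherwise the next step would restart the search. *)
Definition run (z i : nat) : nat :=
  nat_rect (fun _ => nat) (next_state z 0)
    (fun _ y => if (y <=? 0)%nat then 0%nat else next_state z y) i.

(** Follows the convention of [computes_on]: 0 asks for a longer prefix, a successor carries the
    answer, here the code of the [i]-th centre. *)
Definition out (z i : nat) : nat :=
  if (run z i <=? 0)%nat then 0%nat else S (cen (pred (run z i))).

(** * Recursiveness of the search *)

Ltac ctac2_step :=
  first [ctac_step |
  match goal with
  | |- comp (fun x => (_ * _)%nat) => apply comp_mul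
  | |- comp (fun x => f_nat _) => apply comp_f_nat
  | |- comp (fun x => f_inv _) => apply comp_f_inv
  | |- comp (fun x => f_opp _) => apply comp_f_opp
  | |- comp (fun x => f_abs _) => apply comp_f_abs
  | |- comp (fun x => f_add _ _) => apply comp_f_add
  | |- comp (fun x => f_mul _ _) => apply comp_f_mul
  | |- comp (fun x => f_le _ _) => apply comp_f_le
  | |- comp (fun x => f_near _ _) => apply comp_f_near
  | |- comp (fun x => frac_of _) => apply comp_frac_of
  | |- comp (fun x => f_dsq _ _ _) => apply comp_f_dsq; intros ?
  | |- comp (fun x => c_nth _ _) => apply comp_c_nth
  | |- comp (fun x => c_longer _ _) => unfold c_longer; apply comp_leb
  | |- comp (fun x => c_tl _ _) => apply comp_c_tl
  | |- comp (fun x => exists_lt _ _) => apply comp_exists_lt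
  | |- comp (fun x => forall_grid _ _ _) => apply comp_forall_grid
  end].
Ltac ctac2 := repeat (cbv beta; ctac2_step).

Section AlgorithmComp.
Context {X : Type} {EX : Enc X}.

Lemma comp_cert (z m : X -> nat) (l : X -> frac) : comp z -> comp m -> comp l ->
  comp (fun x => cert (fun i => c_nth i (z x)) (m x) (l x)).
Proof. intros. unfold cert, grid_pt, mesh, pt, rad, cen. ctac2. Qed.

Lemma comp_test_step (t b : X -> nat) : comp t -> comp b ->
  comp (fun x => test_step (t x) (b x)).
Proof. intros. unfold test_step, pt, rad, cen. ctac2. Qed.

Lemma comp_test_good (z b m : X -> nat) (l : X -> frac) :
  comp z -> comp b -> comp m -> comp l ->
  comp (fun x => test_good (fun i => c_nth i (z x)) (b x) (m x) (l x)).
Proof.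
  intros. unfold test_good, pt, rad, cen. ctac2. apply comp_cert; assumption.
Qed.

Lemma comp_safe_test (z t w : X -> nat) : comp z -> comp t -> comp w ->
  comp (fun x => safe_test (z x) (t x) (w x)).
Proof.
  intros. unfold safe_test, test.
  ctac2; [apply comp_test_step | apply comp_test_good]; unfold w_ball, w_prec, w_dist; ctac2.
Qed.

End AlgorithmComp.

Lemma comp_next_state {X} {EX : Enc X} (z t : X -> nat) : comp z -> comp t ->
  comp (fun x => next_state (z x) (t x)).
Proof.
  intros Hz Ht.
  assert (comp (fun x => find_lt (z x) (safe_test (z x) (t x)))).
  { apply comp_find_lt; [exact Hz|]. apply comp_safe_test; ctac2. }
  unfold next_state, w_ball. ctac2. apply comp_safe_test; ctac2.
Qed.

Lemma comp_run : comp (fun x : nat * nat => run (fst x) (snd x)).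
Proof.
  unfold run.
  apply (comp_rec snd (fun x => next_state (fst x) 0)
    (fun x _ y => if (y <=? 0)%nat then 0%nat else next_state (fst x) y));
  ctac2; apply comp_next_state; ctac2.
Qed.

Lemma out_recursive : exists e, forall z i, eval e [z; i] (out z i).
Proof.
  assert (H : comp (fun x : nat * nat => out (fst x) (snd x))).
  { pose proof comp_run. unfold out, cen. ctac2. }
  destruct H as [e H]. exists (Rcomp e [r_pair]). intros z i.
  eapply ev_comp; [|apply (H (z, i))].
  eapply evs_cons; [apply ev_pair | apply evs_nil].
Qed.

(** * Dependence of the search on finite prefixes of the input *)

Lemma cert_ext o o' m l : (forall i, (i < 4 * m + 1)%nat -> o i = o' i) ->
  cert o m l = cert o' m l.
Proof.
  intros E. unfold cert. rewrite (E (2 * m)%nat) by lia.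
  apply forall_grid_ext; intros z. f_equal.
  apply exists_lt_ext; intros j Hj. rewrite E by lia. reflexivity.
Qed.

Lemma of_nat_le w : (fst (Cantor.of_nat w) <= w /\ snd (Cantor.of_nat w) <= w)%nat.
Proof.
  rewrite <- (Cantor.cancel_to_of w) at 2 4. destruct (Cantor.of_nat w) as [a b]; cbn [fst snd].
  pose proof (Cantor.to_nat_non_decreasing a b). lia.
Qed.

Lemma w_prec_le w : (w_prec w <= w)%nat.
Proof.
  unfold w_prec. pose proof (of_nat_le w). pose proof (of_nat_le (snd (Cantor.of_nat w))). lia.
Qed.

(** Unpairing does not increase numbers, so the ball index and the precision coded by [w] are at
    most [w], and no entry beyond [4 * w + 3] is read. *)
Lemma test_ext o o' t w : (forall i, (i < 4 * w + 4)%nat -> o i = o' i) ->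
  test o t w = test o' t w.
Proof.
  intros E. pose proof (w_prec_le w). pose proof (of_nat_le w).
  unfold test, test_good. rewrite (E (w_ball w)) by (unfold w_ball; lia).
  rewrite (E (2 * w_prec w)%nat) by lia.
  rewrite (cert_ext o o') by (intros; apply E; lia). reflexivity.
Qed.

Lemma safe_test_prefix (p : baire) k t w :
  safe_test (code_list (prefix p k)) t w = ((4 * w + 3 <? k)%nat && test p t w)%bool.
Proof.
  assert (Lk : length (prefix p k) = k) by (unfold prefix; rewrite length_map, length_seq;
    reflexivity).
  unfold safe_test.
  assert (E : c_longer (4 * w + 3) (code_list (prefix p k)) = (4 * w + 3 <? k)%nat).
  { apply eq_true_iff_eq. rewrite c_longer_code, Nat.ltb_lt, Lk. reflexivity. }
  rewrite E. destruct (Nat.ltb_spec (4 * w + 3) k) as [L|L]; [|reflexivity].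
  f_equal. apply test_ext. intros i Hi. rewrite c_nth_code. unfold prefix.
  rewrite (nth_indep _ 0%nat (p 0%nat)) by (fold (prefix p k); lia).
  rewrite map_nth, seq_nth by lia.
  reflexivity.
Qed.

(** Here [w] is the least witness for the infinite input. Since the number of entries required grows
    with the witness, a prefix too short for [w] could only reveal a smaller one, and there is
    none. *)
Lemma next_state_prefix (p : baire) t : (exists w, test p t w = true) ->
  exists w, test p t w = true /\
    forall k, next_state (code_list (prefix p k)) t =
      if (4 * w + 3 <? k)%nat then S (p (w_ball w)) else 0%nat.
Proof.
  intros [w0 H0].
  destruct (find_lt_spec (S w0) (test p t)) as (L & H1 & H2).
  set (w := find_lt (S w0) (test p t)) in *.
  assert (Hw : test p t w = true).
  { destruct (Nat.eq_dec w (S w0)) as [E|E]; [|apply H2; lia].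
    rewrite (H1 w0) in H0; [discriminate | lia]. }
  exists w; split; [exact Hw|]. intros k.
  assert (Lk : length (prefix p k) = k) by (unfold prefix; rewrite length_map, length_seq;
    reflexivity).
  pose proof (length_le_code (prefix p k)) as Lz. rewrite Lk in Lz.
  set (z := code_list (prefix p k)) in *.
  destruct (find_lt_spec z (safe_test z t)) as (L' & H1' & H2').
  set (w' := find_lt z (safe_test z t)) in *.
  unfold next_state. fold w'.
  destruct (Nat.ltb_spec (4 * w + 3) k) as [Lw|Lw].
  - assert (S : safe_test z t w = true).
    { unfold z; rewrite safe_test_prefix, Hw.
    apply andb_true_intro; split; [apply Nat.ltb_lt; lia|reflexivity]. }
    assert (E : w' = w).
    { destruct (lt_eq_lt_dec w' w) as [[C|C]|C]; [|exact C|].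
      - specialize (H2' ltac:(lia)). unfold z in H2'. rewrite safe_test_prefix, (H1 w' C) in H2'.
        rewrite Bool.andb_false_r in H2'. discriminate.
      - rewrite (H1' w C) in S. discriminate. }
    rewrite E, S. f_equal. unfold z. rewrite c_nth_code. unfold prefix.
    pose proof (of_nat_le w).
    assert (Lb : (w_ball w < k)%nat) by (unfold w_ball; lia).
    rewrite (nth_indep _ 0%nat (p 0%nat)) by (fold (prefix p k); lia).
    rewrite map_nth, seq_nth by lia. reflexivity.
  - destruct (safe_test z t w') eqn:S; [|reflexivity].
    unfold z in S; rewrite safe_test_prefix in S. apply andb_true_iff in S. destruct S as [S1 S2].
    apply Nat.ltb_lt in S1. rewrite (H1 w') in S2; [discriminate | lia].
Qed.

(** The path [b] of the search along the infinite input. Each stage has a threshold on the prefix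
    length, the maximum of the reading bounds of the witnesses so far, below which the run gives 0
    and above which it gives [S (b i)]. *)
Lemma run_prefix (p : baire) (Inv : nat -> Prop) :
  Inv 0%nat ->
  (forall t, Inv t -> exists w, test p t w = true) ->
  (forall t w, Inv t -> test p t w = true -> Inv (S (p (w_ball w)))) ->
  exists b : nat -> nat,
    (forall i, Inv (S (b i))) /\
    (exists w, test p 0 w = true /\ b 0%nat = p (w_ball w)) /\
    (forall i, exists w, test p (S (b i)) w = true /\ b (S i) = p (w_ball w)) /\
    (forall i k, run (code_list (prefix p k)) i = 0%nat \/ run (code_list (prefix p k)) i = S
      (b i)) /\
    (forall i, exists k, run (code_list (prefix p k)) i = S (b i)).
Proof.
  intros I0 IE IS.
  assert (St : forall t, exists w, Inv t -> test p t w = true /\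
    forall k, next_state (code_list (prefix p k)) t =
      if (4 * w + 3 <? k)%nat then S (p (w_ball w)) else 0%nat).
  { intros t. destruct (classic (Inv t)) as [It|It].
    - destruct (next_state_prefix p t (IE t It)) as [w Hw]. exists w; auto.
    - exists 0%nat; tauto. }
  apply functional_choice in St. destruct St as [f Hf].
  set (b := nat_rect (fun _ => nat) (p (w_ball (f 0%nat))) (fun _ y => p (w_ball (f (S y))))).
  assert (Ib : forall i, Inv (S (b i))).
  { induction i as [|i IH]; simpl; eapply IS; try eassumption; apply Hf; assumption. }
  assert (Rb : forall i, exists k0, forall k, run (code_list (prefix p k)) i =
             if (k0 <? k)%nat then S (b i) else 0%nat).
  { induction i as [|i [k0 IH]].
    - exists (4 * f 0%nat + 3)%nat. intros k. apply (Hf 0%nat I0).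
    - exists (max k0 (4 * f (S (b i)) + 3)). intros k.
      change (run (code_list (prefix p k)) (S i)) with
        (if (run (code_list (prefix p k)) i <=? 0)%nat then 0%nat
         else next_state (code_list (prefix p k)) (run (code_list (prefix p k)) i)).
      rewrite IH. destruct (Nat.ltb_spec k0 k) as [L|L]; cbn [Nat.leb].
      + rewrite (proj2 (Hf _ (Ib i))). fold (b i).
        destruct (Nat.ltb_spec (4 * f (S (b i)) + 3) k), (Nat.ltb_spec (max k0 (4 * f (S (b i))
          + 3)) k);
          try lia; reflexivity.
      + destruct (Nat.ltb_spec (max k0 (4 * f (S (b i)) + 3)) k); [lia | reflexivity]. }
  exists b. repeat split.
  - exact Ib.
  - exists (f 0%nat); split; [apply Hf, I0 | reflexivity].
  - intros i. exists (f (S (b i))); split; [apply Hf, Ib | reflexivity].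
  - intros i k. destruct (Rb i) as [k0 H]. rewrite H. destruct (k0 <? k)%nat; auto.
  - intros i. destruct (Rb i) as [k0 H]. exists (S k0). rewrite H.
    destruct (Nat.ltb_spec k0 (S k0)); [reflexivity | lia].
Qed.

End Algorithm.

(** * Correctness *)

Notation rq n c := (nu_Qn_fun n c).
Notation cR n b := (nu_Qn_fun n (cen b)).

Lemma val_pt n c i : (i < n)%nat -> val (pt c i) = nu_Qn_fun n c i.
Proof.
  intros L. unfold pt, nu_Qn_fun. destruct (Nat.ltb_spec i n); [|lia].
  rewrite val_frac_of, c_nth_decode. reflexivity.
Qed.

Lemma val_rad b : val (rad b) = ball_radius b.
Proof.
  unfold rad, ball_radius. rewrite val_f_abs, val_frac_of.
  generalize (nu_Q (snd (Cantor.of_nat b))); intros q.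
  symmetry; apply Qabs_case; intros H; apply Qle_Rle in H; rewrite RMicromega.Q2R_0 in H.
  - rewrite Rabs_pos_eq; lra.
  - rewrite Q2R_opp, Rabs_left1; lra.
Qed.

Lemma radius_nonneg b : 0 <= ball_radius b.
Proof. rewrite <- val_rad. unfold rad. rewrite val_f_abs. apply Rabs_pos. Qed.

Lemma val_dsq n f g :
  val (f_dsq n f g) = sum_lt n (fun i => (val (f i) - val (g i)) ^ 2).
Proof.
  induction n as [|n IH]; cbn [f_dsq sum_lt]; [apply val_f_nat|].
  rewrite val_f_add, val_f_mul, val_f_add, val_f_opp, IH. ring.
Qed.

Lemma f_near_spec n f g rho (F G : nat -> R) :
  (forall i, (i < n)%nat -> val (f i) = F i) -> (forall i, (i < n)%nat -> val (g i) = G i) ->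
  f_near (f_dsq n f g) rho = true <-> dn n F G <= val rho.
Proof.
  intros HF HG. unfold f_near. rewrite andb_true_iff, !f_le_spec, val_f_mul, val_dsq, val_f_nat.
  rewrite (sum_lt_ext n _ (fun i => (F i - G i) ^ 2)) by (intros; rewrite HF, HG; auto).
  pose proof (dsq_nonneg n F G) as D. pose proof (dn_nonneg n F G) as K.
  assert (E : sum_lt n (fun i => (F i - G i) ^ 2) = dn n F G * dn n F G)
    by (unfold dn; rewrite sqrt_sqrt; auto).
  rewrite E. simpl INR. split; [intros [H1 H2] | intros H; split]; nra.
Qed.

Lemma val_mesh n m l : val (mesh n m l) = val l * (INR (S n) / INR (S m)).
Proof. unfold mesh. rewrite val_f_mul. f_equal. unfold val, fst, snd. simpl (INR 0). f_equal.
ring. Qed.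

Lemma nat_floor t : 0 <= t -> exists u : nat, INR u <= t < INR u + 1.
Proof.
  intros H. destruct (archimed t) as [H1 H2].
  exists (Z.to_nat (up t - 1)).
  assert (0 <= up t - 1)%Z by (apply Z.lt_succ_r; apply lt_IZR; unfold Z.succ;
    rewrite plus_IZR, minus_IZR; lra).
  rewrite INR_IZR_INZ, Z2Nat.id, minus_IZR by lia. lra.
Qed.

Lemma grid_round K l s : 0 < l -> - l <= s <= l ->
  exists u, (u < S (2 * S K))%nat /\
    Rabs (l * ((INR u - INR (S K)) / INR (S K)) - s) <= l / INR (S K).
Proof.
  intros Hl Hs. pose proof (INR_S_pos K) as P. set (k := INR (S K)) in *.
  assert (El : l * / l = 1) by (field; lra).
  assert (Il : 0 < / l) by (apply Rinv_0_lt_compat; lra).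
  (* The index of the grid value just below [s]; the hypothesis [- l <= s <= l] keeps it between 0
     and [2 * k]. *)
  destruct (nat_floor (k * (s / l + 1))) as [u Hu].
  { assert (-1 <= s / l) by (unfold Rdiv; nra). nra. }
  exists u. split.
  - apply INR_lt. rewrite S_INR, mult_INR. fold k. simpl (INR 2).
    assert (s / l <= 1) by (unfold Rdiv; nra). nra.
  - replace (l * ((INR u - k) / k) - s) with (l / k * (INR u - k * (s / l + 1))) by (field; lra).
    assert (0 < l / k) by (apply Rdiv_lt_0_compat; lra).
    apply Rabs_le. nra.
Qed.

Lemma dense_code a b : a < b -> exists k, a < val (frac_of k) < b.
Proof.
  intros L. destruct (inv_small (b - a)) as [M HM]; [lra|]. specialize (HM M (le_n M)).
  pose proof (INR_S_pos M) as P.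
  destruct (archimed (a * INR (S M))) as [H1 H2]. set (z := up _) in *.
  (* Every integer has a code: even numbers code the nonnegative ones, odd numbers the negative
     ones. The rational sought is [z / (M + 1)]. *)
  assert (Z : exists k, nu_Z k = z).
  { destruct (Z_lt_le_dec z 0) as [N|N].
    - exists (S (2 * Z.to_nat (- z - 1))). unfold nu_Z.
      rewrite Nat.even_succ, Nat.odd_mul, Nat.div2_succ_double. simpl (Nat.odd 2 && _)%bool.
      cbv iota. lia.
    - exists (2 * Z.to_nat z)%nat. unfold nu_Z. rewrite Nat.even_mul, Nat.div2_double.
      simpl (Nat.even 2 || _)%bool. cbv iota. lia. }
  destruct Z as [k Hk]. exists (Cantor.to_nat (k, M)).
  rewrite val_frac_of. unfold nu_Q. rewrite Cantor.cancel_of_to, Hk.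
  unfold Q2R; simpl Qnum; simpl Qden.
  replace (IZR (Z.pos (Pos.of_succ_nat M))) with (INR (S M)) by (rewrite INR_IZR_INZ;
    reflexivity).
  assert (E : INR (S M) * / INR (S M) = 1) by (field; lra).
  assert (0 < / INR (S M)) by (apply Rinv_0_lt_compat; lra).
  set (v := / INR (S M)) in *. set (u := INR (S M)) in *.
  assert (a = a * u * v) by (rewrite Rmult_assoc, E; ring).
  split; [|apply Rle_lt_trans with (a + v)]; nra.
Qed.

Lemma dense_point n (g : nat -> R) δ : 0 < δ -> exists c, dn n (rq n c) g < δ.
Proof.
  intros Hd. pose proof (INR_S_pos n) as P.
  set (η := δ / INR (S n)). assert (Hη : 0 < η) by (apply Rdiv_lt_0_compat; lra).
  destruct (functional_choice (fun i k => g i - η < val (frac_of k) < g i + η)) as [f Hf].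
  { intros i. apply dense_code. lra. }
  exists (code_list (map f (seq 0 n))).
  apply Rle_lt_trans with (INR n * η).
  - apply dn_le_coord; [lra|]. intros i Hi. rewrite <- val_pt by exact Hi.
    unfold pt. rewrite c_nth_code, (nth_indep _ 0%nat (f 0%nat)) by (rewrite length_map,
      length_seq; exact Hi).
    rewrite map_nth, seq_nth by exact Hi. specialize (Hf (0 + i)%nat). apply Rabs_le.
    simpl in *. lra.
  - unfold η. rewrite S_INR in *. apply Rmult_lt_reg_r with (INR n + 1); [lra|].
    field_simplify; [|lra]. nra.
Qed.

Section Correctness.
Context (n N : nat) (p : baire) (X : nat -> R) (A : Rn n -> Prop) (d : R).
Context (Hx : forall m, dn n (rq n (p (2 * m)%nat)) X <= / INR (S m)).
Context (Hneg : forall y : Rn n, ~ A y <->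
  exists j, dn n (cR n (p (4 * j + 1)%nat)) (coord y) < ball_radius (p (4 * j + 1)%nat)).
Context (Hmeet : forall a, exists y, A y /\
  dn n (cR n (p (4 * a + 3)%nat)) (coord y) < ball_radius (p (4 * a + 3)%nat)).
Context (Hpos : forall k y, A y -> dn n (cR n k) (coord y) < ball_radius k ->
  exists a, cR n (p (4 * a + 3)%nat) = cR n k /\ ball_radius (p (4 * a + 3)%nat) = ball_radius k).
Context (Hd : forall a, A a -> d <= dn n X (coord a)).
Context (Hd' : forall b, (forall a, A a -> b <= dn n X (coord a)) -> b <= d).

Context (Hclosed : Defs.closed_set A).

(** * Certified lower bounds of the distance *)

Local Notation e1 := (1 + / INR (S N)).

Lemma val_grid_pt c m l z i : (i < n)%nat ->
  val (grid_pt c m l z i) =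
  rq n c i + val l * ((INR (c_nth i z) - INR (S m)) / INR (S m)).
Proof. intros L. unfold grid_pt. rewrite val_f_add, val_f_mul, (val_pt n) by exact L.
reflexivity. Qed.

(** A point of [A] closer than [l] to the approximation would lie within [mesh] of a grid point [G].
    Then [G] is not far from the approximation, so it is deep inside a complementary ball, which
    therefore contains the point of [A]. *)
Lemma cert_sound m l a : cert n p m l = true -> A a ->
  val l <= dn n (rq n (p (2 * m)%nat)) (coord a).
Proof.
  intros HC Ha. apply Rnot_lt_le; intros L.
  set (c := rq n (p (2 * m)%nat)) in *.
  pose proof (dn_nonneg n c (coord a)) as D0.
  assert (Hl : 0 < val l) by lra.
  pose proof (INR_S_pos m) as P.
  assert (Hu : forall i, exists u, (i < n)%nat -> (u < S (2 * S m))%nat /\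
    Rabs (val l * ((INR u - INR (S m)) / INR (S m)) - (coord a i - c i)) <= val l / INR (S m)).
  { intros i. destruct (le_lt_dec n i) as [Li|Li]; [exists 0%nat; lia|].
    destruct (grid_round m (val l) (coord a i - c i)) as [u Hu]; [exact Hl| |exists u; auto].
    pose proof (coord_le_dn n c (coord a) i Li) as K. apply Rabs_le_inv in K. lra. }
  apply functional_choice in Hu. destruct Hu as [u Hu].
  set (z := code_list (map u (seq 0 n))).
  assert (Ez : forall i, (i < n)%nat -> c_nth i z = u i).
  { intros i Hi. unfold z. rewrite c_nth_code, (nth_indep _ 0%nat (u 0%nat)) by (rewrite
    length_map, length_seq; exact Hi).
    rewrite map_nth, seq_nth by exact Hi. reflexivity. }
  set (G := fun i => c i + val l * ((INR (c_nth i z) - INR (S m)) / INR (S m))).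
  assert (Q : 0 < val l / INR (S m)) by (apply Rdiv_lt_0_compat; lra).
  assert (GA : dn n G (coord a) < val (mesh n m l)).
  { apply Rle_lt_trans with (INR n * (val l / INR (S m))).
    - apply dn_le_coord; [lra|]. intros i Hi. unfold G. rewrite Ez by exact Hi.
      destruct (Hu i Hi) as [_ K].
      match goal with |- Rabs ?s <= _ => replace s with (val l * ((INR (u i) - INR (S m)) / INR
        (S m)) - (coord a i - c i)) by ring end.
      exact K.
    - rewrite val_mesh, (S_INR n). unfold Rdiv in *. nra. }
  assert (VG : forall i, (i < n)%nat -> val (grid_pt (p (2 * m)%nat) m l z i) = G i)
    by (intros; apply val_grid_pt; assumption).
  unfold cert in HC. rewrite forall_grid_spec in HC.
  specialize (HC (map u (seq 0 n))). rewrite length_map, length_seq in HC.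
  specialize (HC eq_refl). fold z in HC.
  assert (HU : forall v, In v (map u (seq 0 n)) -> (v < S (2 * S m))%nat).
  { intros v Hv. apply in_map_iff in Hv. destruct Hv as (i & <- & Hi). apply in_seq in Hi.
    apply Hu; lia. }
  specialize (HC HU). apply orb_true_iff in HC. destruct HC as [HC|HC].
  - apply negb_true_iff in HC.
    assert (f_near (f_dsq n (grid_pt (p (2 * m)%nat) m l z) (pt (p (2 * m)%nat))) (f_add l
      (mesh n m l)) = true); [|congruence].
    apply (f_near_spec n _ _ _ G c VG); [intros; apply val_pt; assumption|].
    rewrite val_f_add. pose proof (dn_triangle n G (coord a) c).
    rewrite (dn_sym n (coord a)) in *. lra.
  - apply exists_lt_spec in HC. destruct HC as (j & _ & HC).
    apply (f_near_spec n _ _ _ G (cR n (p (4 * j + 1)%nat)) VG) in HC; [|intros; apply val_pt;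
      assumption].
    rewrite val_f_add, val_f_opp, val_rad in HC.
    apply (proj2 (Hneg a)); [|exact Ha]. exists j.
    pose proof (dn_triangle n (cR n (p (4 * j + 1)%nat)) G (coord a)).
    rewrite (dn_sym n _ G) in *. lra.
Qed.

Definition mk_Rn (g : nat -> R) : Rn n.
Proof.
  exists (fun i => if Nat.ltb i n then g i else 0).
  intros i Hi. destruct (Nat.ltb_spec i n); [lia | reflexivity].
Defined.

Lemma coord_mk_Rn g i : (i < n)%nat -> coord (mk_Rn g) i = g i.
Proof. intros L; unfold coord, mk_Rn; simpl. destruct (Nat.ltb_spec i n); [reflexivity | lia].
Qed.

Lemma dn_mk_Rn f g : dn n f (coord (mk_Rn g)) = dn n f g.
Proof. apply dn_ext; intros; auto using coord_mk_Rn. Qed.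

Lemma cert_complete l : 0 < val l < d ->
  exists m0, forall m, (m0 <= m)%nat -> cert n p m l = true.
Proof.
  (* Points within [l'] of [X] avoid [A] because [l' < d], while [l' - val l] leaves room for the
     mesh and the approximation error, one half each. *)
  intros [Hl Hld]. set (l' := (val l + d) / 2).
  pose proof (INR_S_pos n) as Pn.
  set (P := fun m g => l' < dn n g X \/ exists j, (j < m)%nat /\
     dn n g (cR n (p (4 * j + 1)%nat)) <= ball_radius (p (4 * j + 1)%nat) - val (mesh n m l)).
  assert (Dec : forall m m', (m <= m')%nat -> val (mesh n m' l) <= val (mesh n m l)).
  { intros m m' L. rewrite !val_mesh. apply Rmult_le_compat_l; [lra|].
    apply Rmult_le_compat_l; [lra|].
    apply Rinv_le_contravar; [apply INR_S_pos | apply le_INR; lia]. }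
  assert (Small : forall η, 0 < η -> exists m0, forall m, (m0 <= m)%nat -> val (mesh n m l) < η).
  { intros η Hη. destruct (inv_small (η / (val l * INR (S n)))) as [m0 H0].
    { apply Rdiv_lt_0_compat; nra. }
    exists m0; intros m L. specialize (H0 m L). rewrite val_mesh.
    replace (val l * (INR (S n) / INR (S m))) with ((val l * INR (S n)) * / INR (S m)) by
      (unfold Rdiv; ring).
    replace η with ((val l * INR (S n)) * (η / (val l * INR (S n)))) by (field; lra).
    apply Rmult_lt_compat_l; nra. }
  assert (Close : forall g g' δ, 0 < δ -> (forall i, (i < n)%nat ->
    Rabs (g' i - g i) < δ / INR (S n)) ->
                    dn n g' g < δ).
  { intros g g' δ Hδ H. apply Rle_lt_trans with (INR n * (δ / INR (S n))).
    - apply dn_le_coord; [left; apply Rdiv_lt_0_compat; lra|]. intros; left; auto.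
    - replace δ with (INR (S n) * (δ / INR (S n))) at 2 by (field; lra).
      apply Rmult_lt_compat_r; [apply Rdiv_lt_0_compat; lra | apply lt_INR; lia]. }
  (* This box around the origin contains every point within [l'] of [X]. *)
  destruct (box_compact (l' + dn n X (fun _ => 0)) n P) as [m1 Hm1].
  - intros m g [H|(j & Lj & H)]; [left; exact H | right].
    exists j; split; [lia|]. pose proof (Dec m (S m) (Nat.le_succ_diag_r m)). lra.
  - intros g _. destruct (Rlt_le_dec l' (dn n g X)) as [L|L].
    + exists 0%nat, ((dn n g X - l') / INR (S n)). split; [apply Rdiv_lt_0_compat; lra|].
      intros g' Hg'. left. apply Close in Hg'; [|lra].
      pose proof (dn_triangle n g g' X). rewrite (dn_sym n g g') in *. lra.
    + destruct (proj1 (Hneg (mk_Rn g))) as [j Hj].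
      { intros Ag. apply Hd in Ag. rewrite dn_mk_Rn, dn_sym in Ag. unfold l' in L. lra. }
      rewrite dn_mk_Rn in Hj. set (c := cR n (p (4 * j + 1)%nat)) in *.
      set (r := ball_radius (p (4 * j + 1)%nat)) in *.
      (* Half of the depth of [g] in the ball is spent on the mesh, the other half on moving [g]. *)
      destruct (Small ((r - dn n c g) / 2)) as [m0 Hm0]; [lra|].
      exists (max m0 (S j)), ((r - dn n c g) / 2 / INR (S n)).
      split; [apply Rdiv_lt_0_compat; lra|]. intros g' Hg'. right. exists j; split; [lia|].
      apply Close in Hg'; [|lra]. specialize (Hm0 (max m0 (S j)) ltac:(lia)).
      fold c r. pose proof (dn_triangle n g' g c). rewrite (dn_sym n g c) in *. lra.
  - destruct (Small ((l' - val l) / 2)) as [m2 Hm2]; [unfold l'; lra|].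
    destruct (inv_small ((l' - val l) / 2)) as [m3 Hm3]; [unfold l'; lra|].
    exists (max m1 (max m2 m3)). intros m Lm.
    unfold cert. apply forall_grid_spec. intros u _ _. set (z := code_list u).
    set (c := rq n (p (2 * m)%nat)).
    set (G := fun i => c i + val l * ((INR (c_nth i z) - INR (S m)) / INR (S m))).
    assert (VG : forall i, (i < n)%nat -> val (grid_pt (p (2 * m)%nat) m l z i) = G i)
      by (intros; apply val_grid_pt; assumption).
    match goal with |- (negb ?b || _)%bool = true => destruct b eqn:E; [|reflexivity] end.
    apply (f_near_spec n _ _ _ G c VG) in E; [|intros; apply val_pt; assumption].
    rewrite val_f_add in E. cbn [negb orb]. specialize (Hm2 m ltac:(lia)).
    specialize (Hm3 m ltac:(lia)).
    pose proof (dn_triangle n G c X) as T. pose proof (Hx m) as Hxm. fold c in Hxm.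
    assert (GX : dn n G X < l') by lra.
    assert (PG : P m G).
    { apply (mono_le (fun m => P m G)) with m1; [|lia|].
      - intros k [H|(j & Lj & H)]; [left; exact H | right].
        exists j; split; [lia|]. pose proof (Dec k (S k) (Nat.le_succ_diag_r k)). lra.
      - apply Hm1. intros i Hi. pose proof (coord_le_dn n G (fun _ => 0) i Hi) as K.
        cbv beta in K.
        rewrite Rminus_0_r in K. pose proof (dn_triangle n G X (fun _ => 0)). lra. }
    destruct PG as [H|(j & Lj & H)]; [lra|].
    apply exists_lt_spec. exists j; split; [exact Lj|].
    apply (f_near_spec n _ _ _ G (cR n (p (4 * j + 1)%nat)) VG); [intros; apply val_pt;
      assumption|].
    rewrite val_f_add, val_f_opp, val_rad. lra.
Qed.

Lemma d_nonneg : 0 <= d.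
Proof. apply Hd'. intros; apply dn_nonneg. Qed.

Lemma near_exists t : d < t -> exists a, A a /\ dn n X (coord a) < t.
Proof.
  intros L. apply NNPP; intros C. assert (t <= d); [|lra].
  apply Hd'. intros a Ha. apply Rnot_lt_le; intros ?. apply C; exists a; auto.
Qed.

Lemma limit_in g : (forall t, 0 < t -> exists a, A a /\ dn n g (coord a) < t) -> A (mk_Rn g).
Proof.
  intros H. apply NNPP; intros C. destruct (Hclosed _ C) as (r & Hr & K).
  destruct (H r Hr) as (a & Ha & L). apply (K a); [|exact Ha].
  unfold Defs.dist. fold (dn n (coord (mk_Rn g)) (coord a)).
  rewrite dn_sym, dn_mk_Rn, dn_sym. exact L.
Qed.

Lemma e1_bounds : 1 < e1 <= 2.
Proof.
  pose proof (INR_S_pos N) as P. pose proof (Rinv_0_lt_compat _ P).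
  assert (/ INR (S N) <= 1); [|lra]. rewrite <- Rinv_1. apply Rinv_le_contravar; [lra|].
  rewrite S_INR. pose proof (pos_INR N). lra.
Qed.

(** * Tests, invariant and progress of the search *)

Lemma good_near b m l :
  dn n (cR n b) (rq n (p (2 * m)%nat)) <= ball_radius b - / INR (S m) ->
  test_good n N p b m l = true.
Proof.
  intros H. unfold test_good. apply orb_true_iff; left.
  apply (f_near_spec n _ _ _ (cR n b) (rq n (p (2 * m)%nat)));
    [intros; apply val_pt; assumption | intros; apply val_pt; assumption|].
  rewrite val_f_add, val_f_opp, val_rad, val_f_inv. lra.
Qed.

Lemma good_cert b m l : cert n p m l = true ->
  dn n (cR n b) (rq n (p (2 * m)%nat)) <=
    e1 * (val l - / INR (S m)) - ball_radius b - / INR (S m) ->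
  test_good n N p b m l = true.
Proof.
  intros C H. unfold test_good. apply orb_true_iff; right. rewrite C.
  apply (f_near_spec n _ _ _ (cR n b) (rq n (p (2 * m)%nat)));
    [intros; apply val_pt; assumption | intros; apply val_pt; assumption|].
  rewrite !val_f_add, val_f_mul, !val_f_opp, !val_f_add, val_f_opp, val_rad, !val_f_inv,
    val_f_nat.
  simpl (INR 1). lra.
Qed.

Lemma good_sound b m l : test_good n N p b m l = true ->
  dn n (cR n b) X <= ball_radius b \/ dn n (cR n b) X + ball_radius b <= e1 * d.
Proof.
  intros H. unfold test_good in H. apply orb_true_iff in H.
  pose proof (Hx m) as Hm. pose proof (dn_triangle n (cR n b) (rq n (p (2 * m)%nat)) X) as T.
  destruct H as [H|H]; [left | right; apply andb_true_iff in H; destruct H as [C H]];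
  apply (f_near_spec n _ _ _ (cR n b) (rq n (p (2 * m)%nat))) in H;
    try (intros; apply val_pt; assumption).
  - rewrite val_f_add, val_f_opp, val_rad, val_f_inv in H. lra.
  - rewrite !val_f_add, val_f_mul, !val_f_opp, !val_f_add, val_f_opp, val_rad, !val_f_inv,
      val_f_nat in H.
    simpl (INR 1) in H.
    (* The certificate bounds the distance from the approximation, which differs from [X] by at most
       [/ INR (S m)]. *)
    assert (K : val l - / INR (S m) <= d).
    { apply Hd'. intros a Ha. pose proof (cert_sound m l a C Ha).
      pose proof (dn_triangle n (rq n (p (2 * m)%nat)) X (coord a)). lra. }
    pose proof e1_bounds. assert (e1 * (val l - / INR (S m)) <= e1 * d) by (apply
      Rmult_le_compat_l; lra).
    lra.
Qed.

Definition Inv (t : nat) : Prop :=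
  match t with
  | O => True
  | S b => (exists y, A y /\ dn n (cR n b) (coord y) < ball_radius b) /\
           (dn n (cR n b) X <= ball_radius b \/ dn n (cR n b) X + ball_radius b <= e1 * d)
  end.

Lemma test_sound t w : Inv t -> test n N p t w = true -> Inv (S (p (w_ball w))).
Proof.
  intros _ H. apply andb_true_iff in H. destruct H as [_ H].
  split; [|apply good_sound in H; exact H].
  apply Hmeet.
Qed.

Lemma step_init b : test_step n 0 b = true <-> ball_radius b <= / 16.
Proof.
  unfold test_step. simpl (0 <=? 0)%nat. cbv iota.
  rewrite f_le_spec, val_f_mul, !val_f_nat, val_rad. simpl INR. split; lra.
Qed.

Lemma step_next b b' : test_step n (S b) b' = true <->
  ball_radius b' <= ball_radius b / 2 /\ dn n (cR n b') (cR n b) <= 4 * ball_radius b.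
Proof.
  unfold test_step. cbn [Nat.leb pred].
  rewrite andb_true_iff, f_le_spec.
  rewrite (f_near_spec n _ _ _ (cR n b') (cR n b)) by (intros; apply val_pt; assumption).
  rewrite !val_f_mul, !val_f_nat, !val_rad. simpl INR. split; intros [H H']; split; lra.
Qed.

Lemma target_exists t : Inv t -> exists a r, A a /\ 0 < r /\
  (dn n X (coord a) = 0 \/ (0 < d /\ dn n X (coord a) < e1 * d)) /\
  forall b', ball_radius b' <= r -> dn n (cR n b') (coord a) <= ball_radius b' ->
             test_step n t b' = true.
Proof.
  intros It. pose proof d_nonneg as D0. pose proof e1_bounds as [E1 E2].
  assert (Zero : d = 0 -> A (mk_Rn X) /\ dn n X (coord (mk_Rn X)) = 0).
  { intros E. split; [|rewrite dn_mk_Rn; apply dn_refl].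
    apply limit_in. intros t' Ht'. apply near_exists. lra. }
  destruct t as [|b].
  - assert (exists a, A a /\ (dn n X (coord a) = 0 \/ (0 < d /\ dn n X (coord a) < e1 * d)))
      as (a & Ha & K).
    { destruct D0 as [D0|D0].
      - destruct (near_exists (e1 * d)) as (a & Ha & L); [nra|]. exists a; auto.
      - exists (mk_Rn X). destruct Zero; auto. }
    exists a, (/ 16). repeat split; [exact Ha | lra | exact K|].
    intros b' H _. apply step_init, H.
  - destruct It as [(y & Hy & Ly) G].
    pose proof (dn_nonneg n (cR n b) (coord y)).
    pose proof (dn_nonneg n (cR n b) X).
    set (r := ball_radius b) in *.
    assert (exists a, A a /\ (dn n X (coord a) = 0 \/ (0 < d /\ dn n X (coord a) < e1 * d)) /\
              dn n (cR n b) (coord a) <= 3 * r) as (a & Ha & K & L).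
    { pose proof (dn_triangle n X (cR n b) (coord y)) as T. rewrite (dn_sym n X (cR n b)) in T.
      pose proof (Hd y Hy).
      destruct D0 as [D0|D0].
      - destruct G as [G|G].
        (* [d < 2 * r], because the centre is within [r] of [X] and the ball contains [y]. The point
           obtained is within [r + 2 * r] of the centre. *)
        + destruct (near_exists (Rmin (e1 * d) (2 * r))) as (a & Ha & La).
          { apply Rmin_glb_lt; nra. }
          exists a. pose proof (Rmin_l (e1 * d) (2 * r)). pose proof (Rmin_r (e1 * d) (2 * r)).
          pose proof (dn_triangle n (cR n b) X (coord a)).
          repeat split; [exact Ha | right; lra | lra].
        (* Any point of [A] inside a ball of the second kind is strictly closer to [X] than
           [e1 * d]. *)
        + exists y. repeat split; [exact Hy | right; lra | lra].
      - destruct (Zero (eq_sym D0)) as [Z1 Z2]. exists (mk_Rn X).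
        repeat split; [exact Z1 | left; exact Z2|]. rewrite dn_mk_Rn.
        rewrite <- D0 in G. lra. }
    (* Radius [r / 2] meets the halving condition, and [3 * r + r / 2] is below the permitted move
       [4 * r]. *)
    exists a, (r / 2). repeat split; [exact Ha | lra | exact K|].
    intros b' H1 H2. apply step_next. fold r.
    pose proof (dn_triangle n (cR n b') (coord a) (cR n b)). rewrite (dn_sym n (coord a)) in *.
    lra.
Qed.

(** A rational ball with these properties exists by density and meets [A], so it is enumerated.
    Keeping [a] within half the radius leaves room for approximation errors in the tests. *)
Lemma small_ball a r : A a -> 0 < r -> exists i,
  ball_radius (p (4 * i + 3)%nat) <= r /\ 0 < ball_radius (p (4 * i + 3)%nat) /\
  dn n (cR n (p (4 * i + 3)%nat)) (coord a) <= ball_radius (p (4 * i + 3)%nat) / 2.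
Proof.
  intros Ha Hr. destruct (dense_code 0 r Hr) as [k Hk].
  destruct (dense_point n (coord a) (val (frac_of k) / 2)) as [c Hc]; [lra|].
  set (b := Cantor.to_nat (c, k)).
  assert (Rb : ball_radius b = val (frac_of k)).
  { rewrite <- val_rad. unfold rad, b. rewrite Cantor.cancel_of_to. cbn [snd].
    rewrite val_f_abs, Rabs_pos_eq; lra. }
  assert (Cb : cen b = c) by (unfold cen, b; rewrite Cantor.cancel_of_to; reflexivity).
  destruct (Hpos b a Ha) as (i & E1 & E2); [rewrite Cb, Rb; lra|].
  exists i. rewrite E1, E2, Cb, Rb. lra.
Qed.

Lemma test_complete t : Inv t -> exists w, test n N p t w = true.
Proof.
  intros It. destruct (target_exists t It) as (a & r & Ha & Hr & K & St).
  pose proof e1_bounds as [E1 E2].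
  enough (exists i m k, ball_radius (p (4 * i + 3)%nat) <= r /\
     dn n (cR n (p (4 * i + 3)%nat)) (coord a) <= ball_radius (p (4 * i + 3)%nat) /\
     test_good n N p (p (4 * i + 3)%nat) m (f_abs (frac_of k)) = true)
    as (i & m & k & L1 & L2 & G).
  { exists (Cantor.to_nat (i, Cantor.to_nat (m, k))).
    unfold test, w_ball, w_prec, w_dist. rewrite !Cantor.cancel_of_to; cbn [fst snd].
    rewrite !Cantor.cancel_of_to; cbn [fst snd]. rewrite G, St; auto. }
  destruct K as [K|[D0 K]].
  - destruct (small_ball a r Ha Hr) as (i & L1 & L2 & L3).
    set (b := p (4 * i + 3)%nat) in *.
    destruct (inv_small (ball_radius b / 4)) as [m Hm]; [lra|]. specialize (Hm m (le_n m)).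
    exists i, m, 0%nat. fold b. repeat split; [exact L1 | lra|]. apply good_near.
    pose proof (Hx m). pose proof (dn_triangle n (cR n b) (coord a) (rq n (p (2 * m)%nat))).
    pose proof (dn_triangle n (coord a) X (rq n (p (2 * m)%nat))).
    rewrite (dn_sym n (coord a) X), (dn_sym n X (rq n _)) in *. lra.
  - pose proof (dn_nonneg n X (coord a)) as Q0.
    (* The interval is nonempty because [a] is strictly closer to [X] than [e1 * d]; a rational in
       it lies below [d], hence can be certified, and leaves the gap [η]. *)
    destruct (dense_code (dn n X (coord a) / e1) d) as [k Hk].
    { apply Rmult_lt_reg_r with e1; [lra|]. unfold Rdiv. rewrite Rmult_assoc, Rinv_l by lra.
    lra. }
    assert (P0 : 0 <= dn n X (coord a) / e1) by (apply Rle_mult_inv_pos; lra).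
    assert (Vl : val (f_abs (frac_of k)) = val (frac_of k)) by (rewrite val_f_abs, Rabs_pos_eq;
      lra).
    set (l := val (frac_of k)) in *.
    assert (Gap : 0 < e1 * l - dn n X (coord a)).
    { destruct Hk as [Hk _]. apply Rmult_lt_compat_r with (r := e1) in Hk; [|lra].
      unfold Rdiv in Hk. rewrite Rmult_assoc, Rinv_l in Hk by lra. lra. }
    set (η := e1 * l - dn n X (coord a)) in *.
    (* Budget: the ball costs 3/2 of its radius, at most [3 * η / 8]; the approximation errors cost
       at most 4 times [/ INR (S m)], below [η / 2], because [e1 <= 2]. *)
    destruct (small_ball a (Rmin r (η / 4)) Ha) as (i & L1 & L2 & L3).
    { apply Rmin_glb_lt; lra. }
    set (b := p (4 * i + 3)%nat) in *.
    pose proof (Rmin_l r (η / 4)). pose proof (Rmin_r r (η / 4)).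
    destruct (inv_small (η / 8)) as [m1 Hm1]; [lra|].
    destruct (cert_complete (f_abs (frac_of k))) as [m2 Hm2]; [rewrite Vl; lra|].
    set (m := max m1 m2). specialize (Hm1 m ltac:(lia)). specialize (Hm2 m ltac:(lia)).
    exists i, m, k. fold b. repeat split; [lra | lra|]. apply good_cert; [exact Hm2|].
    rewrite Vl. pose proof (Hx m).
    pose proof (dn_triangle n (cR n b) (coord a) (rq n (p (2 * m)%nat))).
    pose proof (dn_triangle n (coord a) X (rq n (p (2 * m)%nat))).
    rewrite (dn_sym n (coord a) X), (dn_sym n X (rq n _)) in *.
    pose proof (Rinv_0_lt_compat _ (INR_S_pos m)) as Im.
    assert (e1 * / INR (S m) <= 2 * / INR (S m)) by (apply Rmult_le_compat_r; lra).
    unfold η in *. rewrite Rmult_minus_distr_l. lra.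
Qed.

(** * Convergence of the ball centres *)

Lemma inv_pow_le i : / 2 ^ i <= / INR (S i).
Proof.
  apply Rinv_le_contravar; [apply INR_S_pos|].
  induction i as [|i IH]; [simpl; lra|].
  rewrite S_INR. simpl (2 ^ S i). pose proof (INR_S_pos i). rewrite S_INR in *.
  pose proof (pos_INR i). lra.
Qed.

Section Limit.
Context (b : nat -> nat) (Ib : forall i, Inv (S (b i))).
Context (B0 : ball_radius (b 0%nat) <= / 16).
Context (BS : forall i, ball_radius (b (S i)) <= ball_radius (b i) / 2 /\
  dn n (cR n (b (S i))) (cR n (b i)) <= 4 * ball_radius (b i)).

Lemma radius_bound i : ball_radius (b i) <= / 2 ^ i / 16.
Proof.
  induction i as [|i IH]; [simpl; lra|]. destruct (BS i) as [H _].
  simpl (2 ^ S i). rewrite Rinv_mult. lra.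
Qed.

Lemma radius_small t : 0 < t -> exists i0, forall i, (i0 <= i)%nat -> ball_radius (b i) < t.
Proof.
  intros Ht. destruct (inv_small t Ht) as [i0 H0]. exists i0; intros i Hi.
  specialize (H0 i Hi). pose proof (radius_bound i). pose proof (inv_pow_le i).
  pose proof (Rinv_0_lt_compat _ (INR_S_pos i)). lra.
Qed.

Lemma center_dist i j : (i <= j)%nat ->
  dn n (cR n (b i)) (cR n (b j)) <= 8 * ball_radius (b i).
Proof.
  intros L.
  (* The subtracted term makes the induction telescope: halving gives that the move of 4 radii is at
     most 8 times the decrease of the radius. *)
  assert (dn n (cR n (b i)) (cR n (b j)) <= 8 * ball_radius (b i) - 8 * ball_radius (b j)).
  { induction L as [|j L IH]; [rewrite dn_refl; lra|].
    destruct (BS j) as [H1 H2]. rewrite dn_sym in H2.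
    pose proof (dn_triangle n (cR n (b i)) (cR n (b j)) (cR n (b (S j)))). lra. }
  pose proof (radius_nonneg (b j)). lra.
Qed.

(** Limits are taken coordinatewise; the factor [INR n] is the price of returning from coordinates
    to the Euclidean distance. *)
Lemma center_limit : exists Y : nat -> R,
  forall j, dn n (cR n (b j)) Y <= INR n * (8 * ball_radius (b j)).
Proof.
  destruct (functional_choice (fun i y => (i < n)%nat ->
    Un_cv (fun j => cR n (b j) i) y)) as [Y HY].
  { intros i. destruct (le_lt_dec n i) as [L|L]; [exists 0; lia|].
    destruct (R_complete (fun j => cR n (b j) i)) as [y Hy]; [|exists y; auto].
    intros t Ht. destruct (radius_small (t / 16)) as [i0 H0]; [lra|].
    exists i0. intros j k Hj Hk. unfold Rdist.
    specialize (H0 i0 (le_n _)).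
    pose proof (center_dist i0 j Hj) as Dj. pose proof (center_dist i0 k Hk) as Dk.
    rewrite dn_sym in Dj. pose proof (dn_triangle n (cR n (b j)) (cR n (b i0)) (cR n (b k))).
    pose proof (coord_le_dn n (cR n (b j)) (cR n (b k)) i L). lra. }
  exists Y. intros j. apply dn_le_coord; [pose proof (radius_nonneg (b j)); lra|].
  intros i Hi. apply Rnot_lt_le; intros C.
  destruct (HY i Hi (Rabs (cR n (b j) i - Y i) - 8 * ball_radius (b j))) as [k0 Hk]; [lra|].
  specialize (Hk (max j k0) ltac:(lia)). unfold Rdist in Hk.
  pose proof (center_dist j (max j k0) ltac:(lia)).
  pose proof (coord_le_dn n (cR n (b j)) (cR n (b (max j k0))) i Hi).
  pose proof (Rabs_triang (cR n (b j) i - cR n (b (max j k0)) i) (cR n (b (max j k0)) i - Y i))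
    as T.
  replace (cR n (b j) i - cR n (b (max j k0)) i + (cR n (b (max j k0)) i - Y i))
    with (cR n (b j) i - Y i) in T by ring. lra.
Qed.

Lemma limit_spec : exists Y : Rn n,
  cauchy_name n (fun i => cen (b i)) Y /\ A Y /\ dn n X (coord Y) <= e1 * d.
Proof.
  destruct center_limit as [Y HY]. exists (mk_Rn Y).
  pose proof (pos_INR n) as Pn.
  assert (Small : forall t, 0 < t -> exists i0, forall i, (i0 <= i)%nat ->
            dn n (cR n (b i)) Y + ball_radius (b i) < t).
  { intros t Ht. destruct (radius_small (t / (8 * INR n + 1))) as [i0 H0].
    { apply Rdiv_lt_0_compat; lra. }
    exists i0; intros i Hi. specialize (H0 i Hi). specialize (HY i).
    apply (Rmult_lt_compat_r (8 * INR n + 1)) in H0; [|lra].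
    unfold Rdiv in H0. rewrite Rmult_assoc, Rinv_l in H0 by lra. lra. }
  split; [split|split].
  - intros i j L. unfold Defs.dist.
    apply Rle_trans with (1 := center_dist i j L).
    pose proof (radius_bound i). pose proof (radius_nonneg (b i)).
    pose proof (Rinv_0_lt_compat (2 ^ i) ltac:(apply pow_lt; lra)). lra.
  - intros t Ht. destruct (Small t Ht) as [i0 H0]. exists i0; intros i Hi.
    specialize (H0 i Hi). change (dn n (cR n (b i)) (coord (mk_Rn Y)) < t).
    rewrite dn_mk_Rn. pose proof (radius_nonneg (b i)). lra.
  - apply limit_in. intros t Ht. destruct (Small t Ht) as [i H0]. specialize (H0 i (le_n i)).
    destruct (Ib i) as [(a & Ha & La) _]. exists a; split; [exact Ha|].
    pose proof (dn_triangle n Y (cR n (b i)) (coord a)) as T.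
    rewrite (dn_sym n Y (cR n (b i))) in T. lra.
  (* Either alternative of [Inv] puts the centre within the radius plus [e1 * d] of [X], and [Small]
     makes the remaining terms less than [t]. *)
  - rewrite dn_mk_Rn. apply le_epsilon. intros t Ht. destruct (Small t Ht) as [i H0].
    specialize (H0 i (le_n i)). pose proof d_nonneg. pose proof e1_bounds.
    pose proof (radius_nonneg (b i)). assert (0 <= e1 * d) by (apply Rmult_le_pos; lra).
    pose proof (dn_triangle n X (cR n (b i)) Y) as T. rewrite (dn_sym n X (cR n (b i))) in T.
    destruct (Ib i) as [_ [G|G]]; lra.
Qed.

End Limit.

Lemma algorithm_correct e : (forall z i, eval e [z; i] (out n N z i)) ->
  exists q, computes_on e p q /\
    exists Y : Rn n, cauchy_name n q Y /\ A Y /\ dn n X (coord Y) <= e1 * d.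
Proof.
  intros He.
  destruct (run_prefix n N p Inv I test_complete test_sound)
    as (b & Ib & (w0 & T0 & E0) & HS & Hrun & Hex).
  exists (fun i => cen (b i)). split.
  - intros i. split.
    + destruct (Hex i) as [k Hk]. exists k.
      replace (S (cen (b i))) with (out n N (code_list (prefix p k)) i); [apply He|].
      unfold out. rewrite Hk. reflexivity.
    (* Any value of [e] must be that of [out], which on a prefix is either 0 or the one fixed
       answer. *)
    + intros k v Hv. pose proof (eval_functional e _ _ _ Hv (He (code_list (prefix p k)) i)) as E.
      unfold out in E. destruct (Hrun i k) as [R|R]; rewrite R in E; cbn [Nat.leb pred] in E;
        congruence.
  - apply limit_spec; [exact Ib | |].
    + rewrite E0. apply step_init. apply andb_true_iff in T0. apply T0.
    + intros i. destruct (HS i) as (w & Tw & Ew). rewrite Ew.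
      apply step_next. apply andb_true_iff in Tw. apply Tw.
Qed.

End Correctness.

(** * From names to the projection *)

Lemma cauchy_name_bound n p (x : Rn n) m : cauchy_name n p x ->
  dn n (rq n (p m)) (coord x) <= / INR (S m).
Proof.
  intros [H1 H2]. apply Rle_trans with (/ 2 ^ m); [|apply inv_pow_le].
  apply le_epsilon. intros t Ht. destruct (H2 t Ht) as [k Hk].
  specialize (Hk (max k m) ltac:(lia)). specialize (H1 m (max k m) ltac:(lia)).
  change (dn n (rq n (p (max k m))) (coord x) < t) in Hk.
  change (dn n (rq n (p m)) (rq n (p (max k m))) <= / 2 ^ m) in H1.
  pose proof (dn_triangle n (rq n (p m)) (rq n (p (max k m))) (coord x)). lra.
Qed.

Theorem theorem5p9 : forall (eps : R) (n : nat),
  0 < eps -> (1 <= n)%nat -> eps_Proj_computable eps n.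
Proof.
  intros eps n Heps _.
  (* Only the rational [/ INR (S N)] below [eps] enters the program, so [eps] may be any positive
     real, computable or not. *)
  destruct (inv_small eps Heps) as [N HN]. specialize (HN N (le_n N)).
  destruct (out_recursive n N) as [e He]. exists e.
  intros p x A [Hx [Hneg Hpos]] [[a0 Ha0] Hcl].
  (* The distance to [A] is the negative of the supremum of the negated distances, a nonempty set
     bounded above by 0. *)
  destruct (completeness (fun s => exists a, A a /\ s = - dn n (coord x) (coord a))) as [D [ub
    lub]].
  { exists 0. intros s (a & _ & ->). pose proof (dn_nonneg n (coord x) (coord a)). lra. }
  { exists (- dn n (coord x) (coord a0)). exists a0; auto. }
  set (d := - D).
  assert (Hd : forall a, A a -> d <= dn n (coord x) (coord a)).
  { intros a Ha. specialize (ub _ (ex_intro _ a (conj Ha eq_refl))). unfold d. lra. }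
  assert (Hd' : forall t, (forall a, A a -> t <= dn n (coord x) (coord a)) -> t <= d).
  { intros t Ht. assert (D <= - t); [|unfold d; lra]. apply lub. intros s (a & Ha & ->).
    specialize (Ht a Ha). lra. }
  assert (E1 : forall j, pi1 (pi2 p) j = p (4 * j + 1)%nat)
    by (intros j; unfold pi1, pi2; f_equal; lia).
  assert (E2 : forall j, pi2 (pi2 p) j = p (4 * j + 3)%nat)
    by (intros j; unfold pi2; f_equal; lia).
  destruct (algorithm_correct n N p (coord x) A d) with (e := e) as (q & Hq & Y & HY & AY & LY).
  - intros m. apply (cauchy_name_bound n (pi1 p) x m Hx).
  - intros y. rewrite (Hneg y). split; intros [j Hj]; exists j; [rewrite <- E1 | rewrite E1];
      exact Hj.
  - intros i. destruct (proj2 (Hpos (pi2 (pi2 p) i))) as (y & Ay & Hy); [exists i; auto|].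
    exists y; split; [exact Ay|]. rewrite <- E2. exact Hy.
  - intros k y Ay Hy. destruct (proj1 (Hpos k)) as (i & C & Rk); [exists y; auto|].
    exists i. rewrite <- E2. split; [|exact Rk]. exact (f_equal (@proj1_sig _ _) C).
  - exact Hd.
  - exact Hd'.
  - exact Hcl.
  - exact He.
  - exists q. split; [exact Hq|]. exists Y. split; [exact HY|]. split; [exact AY|].
    exists d. split.
    + split; [intros s (a & Ha & ->); apply Hd, Ha|].
      intros t Ht. apply Hd'. intros a Ha. apply Ht. exists a; auto.
    + change (dn n (coord x) (coord Y) <= (1 + eps) * d).
      assert (0 <= d) by (apply Hd'; intros; apply dn_nonneg).
      apply Rle_trans with (1 := LY). apply Rmult_le_compat_r; lra.
Qed.
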